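(* Let $\sigma>0$ and $m>0$ be fixed. If $(w,s)$ is a solution to problem $(P_1)$, then a parametric explicit solution $(\theta,Y_0,Y_1)$ to problem $(P_4)$ is given by $$\theta(y,t)=\frac{m\,w_z(z,t)w(z,t)-\frac{\sigma}{2}w^{2}(z,t)}{w_{zz}(z,t)w(z,t)-w_z^{2}(z,t)},\qquad Y_0(t)\le y\le Y_1(t),\ t>0,$$ $$y=\frac1m\ln\left(1-\frac{2m\,w_z(z,t)}{\sigma\, w(z,t)}\right),\qquad 0\le z\le s(t),\ t>0,$$ where $z$ is the parameter and the free boundaries are $$Y_0(t)=\frac1m\ln\left(1-\frac{2m\,w_z(0,t)}{\sigma\,w(0,t)}\right),\qquad Y_1(t)=\frac1m\ln\left(1-\frac{2m\,w_z(s(t),t)}{\sigma\,w(s(t),t)}\right),\qquad t>0.$$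
   Context: Data: $L=L(t)$ and $v=v(t)$ are continuous and positive for $t>0$; $w_m=w_m(t)$ is differentiable, $v(t)>w_m(t)>0$ for $t>0$, and $v(0)=w_m(0)$. Problem $(P_1)$, with unknowns $(w,s)$: $w_{zz}=w_t$ for $0<z<s(t)$, $t>0$; $w_z(s(t),t)=-L(t)s'(t)$, $t>0$; $w(s(t),t)=w_m(t)$, $t>0$; $w(0,t)=v(t)$, $t>0$; $s(0)=0$. A pair $(w,s)$ is a solution of $(P_1)$ if $w,w_z,w_t,w_{zz}$ are continuous in $\{(z,t):0<z<s(t),\ t>0\}$ and all these conditions are satisfied. The paper takes from the literature (Friedman, 1959) that such $w$ satisfies $w>0$ and $w_z\le 0$ up to the boundaries $z=0$ and $z=s(t)$, so that the quotients and logarithms make sense. Problem $(P_4)$, with unknowns $(\theta,Y_0,Y_1)$: $\theta_t=-(\theta^{-1})_{yy}-m(\theta^{-1})_y+\sigma\exp(my)$ for $Y_0(t)<y<Y_1(t)$, $t>0$; $Y_1(t)=\frac{\ln(1+mI_1(t))}{m}$, $t>0$; $\theta(Y_1(t),t)=\exp(mY_1(t))\left(-\frac{2}{\sigma}\frac{w_m'(t)}{w_m(t)}+\frac{\sigma(\exp(mY_1(t))-1)^2}{2m^2}\left(1-\frac{w_m(t)}{L(t)}\right)\right)^{-1}$, $t>0$; $\int_0^t\left(\frac{\sigma^2(\exp(mY_0(\tau))-1)^2}{4m^2}-\frac{\sigma\exp(mY_0(\tau))}{2\theta(Y_0(\tau),\tau)}\right)d\tau=\ln\left(\frac{v(t)}{w_m(0)}\right)$,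 $t>0$; $Y_0(t)=\frac{\ln(1+mI_0(t))}{m}$, $t>0$; where $I_0(t)=-\int_0^t\exp(mY_0(\tau))\left(\frac{\sigma(\exp(mY_0(\tau))-1)}{m\theta(Y_0(\tau),\tau)}+\frac{\theta_y(Y_0(\tau),\tau)-m\theta(Y_0(\tau),\tau)}{\theta^3(Y_0(\tau),\tau)}\right)d\tau$, $I_1(t)=\int_0^t\exp(mY_1(\tau))\left(\frac{\sigma(\exp(mY_1(\tau))-1)}{m\theta(Y_1(\tau),\tau)}\left(\frac{w_m(\tau)}{2L(\tau)}-1\right)-\frac{\theta_y(Y_1(\tau),\tau)-m\theta(Y_1(\tau),\tau)}{\theta^3(Y_1(\tau),\tau)}\right)d\tau$.
   Formalization: Added: w, w_z, w_zz, w_zzz exist and are continuous up to z=0, z=s(t); w_zz w − w_z² is nonzero there; Y_0<Y_1; w_m(0)>0; s, v, w_m are continuous at t=0; w_z(s(t),t)→0 as t→0+ (the claim fails for w=e^{-t}cos(z+a) otherwise). *)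

(* Defs.v *)
From Stdlib Require Export Reals.
From Coquelicot Require Export Coquelicot.
Open Scope R_scope.

(* A function of (space, time) is curried, space variable first. *)
Definition continuous2_on (D : R -> R -> Prop) (f : R -> R -> R) : Prop :=
  continuous_on (fun p : R * R => D (fst p) (snd p))
                (fun p : R * R => f (fst p) (snd p)).

(* The region between two curves x = a(t) and x = b(t) for t > 0, without and
   with its lateral boundary. *)
Definition region (a b : R -> R) (x t : R) : Prop := 0 < t /\ a t < x < b t.
Definition cl_region (a b : R -> R) (x t : R) : Prop := 0 < t /\ a t <= x <= b t.

(* fx is the space derivative of f on the slices of D.  [D_in] only sees points
   of the slice, so that at an end of a closed slice the derivative is
   one-sided. *)
Definition space_deriv (D : R -> R -> Prop) (f fx : R -> R -> R) : Prop :=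
  forall x t, D x t ->
    D_in (fun x' => f x' t) (fun x' => fx x' t) (fun x' => D x' t) x.

Definition zero_curve : R -> R := fun _ => 0.

Record P1_data (L v wm : R -> R) : Prop := {
  data_L_cont : continuous_on (fun t => 0 < t) L;
  data_L_pos : forall t, 0 < t -> 0 < L t;
  (* The values v(0) and wm(0) are the limits at t = 0. *)
  data_v_cont : continuous_on (fun t => 0 <= t) v;
  data_v_pos : forall t, 0 < t -> 0 < v t;
  data_wm_cont : continuous_on (fun t => 0 <= t) wm;
  data_wm_diff : forall t, 0 < t -> ex_derive wm t;
  data_wm_bounds : forall t, 0 < t -> 0 < wm t < v t;
  data_initial : v 0 = wm 0
}.

(* wz, wt, wzz are the derivatives w_z, w_t, w_zz.  The derivative w_z is needed
   up to the lateral boundary: it occurs in the condition on z = s(t). *)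
Record P1_solution (L v wm : R -> R) (w wz wt wzz : R -> R -> R) (s : R -> R)
  : Prop := {
  P1_s_pos : forall t, 0 < t -> 0 < s t;
  P1_s_cont : continuous_on (fun t => 0 <= t) s;
  P1_s_diff : forall t, 0 < t -> ex_derive s t;
  P1_wz : space_deriv (cl_region zero_curve s) w wz;
  P1_wzz : space_deriv (region zero_curve s) wz wzz;
  P1_wt : forall z t, region zero_curve s z t ->
    is_derive (fun t' => w z t') t (wt z t);
  P1_w_cont : continuous2_on (region zero_curve s) w;
  P1_wz_cont : continuous2_on (region zero_curve s) wz;
  P1_wt_cont : continuous2_on (region zero_curve s) wt;
  P1_wzz_cont : continuous2_on (region zero_curve s) wzz;
  P1_heat : forall z t, region zero_curve s z t -> wzz z t = wt z t;
  P1_stefan : forall t, 0 < t -> wz (s t) t = - L t * Derive s t;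
  P1_free_value : forall t, 0 < t -> w (s t) t = wm t;
  P1_fixed_value : forall t, 0 < t -> w 0 t = v t;
  P1_s0 : s 0 = 0
}.

(* Regularity up to z = 0 and z = s(t): theta(Y_i(t),t) involves w_zz, and
   theta_y(Y_i(t),t) involves w_zzz, on these curves. *)
Record lateral_regularity (w wz wzz wzzz : R -> R -> R) (s : R -> R) : Prop := {
  lat_wzz : space_deriv (cl_region zero_curve s) wz wzz;
  lat_wzzz : space_deriv (cl_region zero_curve s) wzz wzzz;
  lat_w_cont : continuous2_on (cl_region zero_curve s) w;
  lat_wz_cont : continuous2_on (cl_region zero_curve s) wz;
  lat_wzz_cont : continuous2_on (cl_region zero_curve s) wzz;
  lat_wzzz_cont : continuous2_on (cl_region zero_curve s) wzzz
}.

(* Integral from 0 to t, improper at 0: the integrands below are only defined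
   for positive times. *)
Definition ex_RInt0 (f : R -> R) (t : R) : Prop :=
  ex_RInt_gen f (at_right 0) (at_point t).
Definition RInt0 (f : R -> R) (t : R) : R :=
  RInt_gen f (at_right 0) (at_point t).

Section P4.

Variables (sigma m : R) (L v wm : R -> R).

Definition I0_integrand (theta theta_y : R -> R -> R) (Y0 : R -> R) (tau : R) : R :=
  let y := Y0 tau in
  exp (m * y) *
    (sigma * (exp (m * y) - 1) / (m * theta y tau)
     + (theta_y y tau - m * theta y tau) / theta y tau ^ 3).

Definition I0 theta theta_y Y0 (t : R) : R :=
  - RInt0 (I0_integrand theta theta_y Y0) t.

Definition I1_integrand (theta theta_y : R -> R -> R) (Y1 : R -> R) (tau : R) : R :=
  let y := Y1 tau in
  exp (m * y) *
    (sigma * (exp (m * y) - 1) / (m * theta y tau) * (wm tau / (2 * L tau) - 1)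
     - (theta_y y tau - m * theta y tau) / theta y tau ^ 3).

Definition I1 theta theta_y Y1 (t : R) : R :=
  RInt0 (I1_integrand theta theta_y Y1) t.

Definition Y1_bracket (Y1 : R -> R) (t : R) : R :=
  - (2 / sigma) * (Derive wm t / wm t)
  + sigma * (exp (m * Y1 t) - 1) ^ 2 / (2 * m ^ 2) * (1 - wm t / L t).

Definition Y0_integrand (theta : R -> R -> R) (Y0 : R -> R) (tau : R) : R :=
  let y := Y0 tau in
  sigma ^ 2 * (exp (m * y) - 1) ^ 2 / (4 * m ^ 2)
  - sigma * exp (m * y) / (2 * theta y tau).

(* [Rinv] and [ln] are total, hence the clauses that divisors are nonzero and
   arguments of logarithms positive. *)
Record P4_solution (theta theta_y : R -> R -> R) (Y0 Y1 : R -> R) : Prop := {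
  P4_order : forall t, 0 < t -> Y0 t < Y1 t;
  P4_theta_neq0 : forall y t, cl_region Y0 Y1 y t -> theta y t <> 0;
  P4_theta_y : space_deriv (cl_region Y0 Y1) theta theta_y;
  P4_theta_cont : continuous2_on (cl_region Y0 Y1) theta;
  P4_theta_y_cont : continuous2_on (cl_region Y0 Y1) theta_y;
  P4_theta_t : forall y t, region Y0 Y1 y t ->
    ex_derive (fun t' => theta y t') t;
  P4_theta_t_cont : continuous2_on (region Y0 Y1)
    (fun y t => Derive (fun t' => theta y t') t);
  P4_theta_inv_y : forall y t, region Y0 Y1 y t ->
    ex_derive (fun y' => / theta y' t) y;
  P4_theta_inv_yy : forall y t, region Y0 Y1 y t ->
    ex_derive_n (fun y' => / theta y' t) 2 y;
  P4_theta_inv_yy_cont : continuous2_on (region Y0 Y1)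
    (fun y t => Derive_n (fun y' => / theta y' t) 2 y);
  P4_pde : forall y t, region Y0 Y1 y t ->
    Derive (fun t' => theta y t') t =
      - Derive_n (fun y' => / theta y' t) 2 y
      - m * Derive (fun y' => / theta y' t) y
      + sigma * exp (m * y);
  P4_I1_conv : forall t, 0 < t -> ex_RInt0 (I1_integrand theta theta_y Y1) t;
  P4_I1_pos : forall t, 0 < t -> 0 < 1 + m * I1 theta theta_y Y1 t;
  P4_Y1 : forall t, 0 < t -> Y1 t = ln (1 + m * I1 theta theta_y Y1 t) / m;
  P4_bracket_neq0 : forall t, 0 < t -> Y1_bracket Y1 t <> 0;
  P4_theta_Y1 : forall t, 0 < t ->
    theta (Y1 t) t = exp (m * Y1 t) * / Y1_bracket Y1 t;
  P4_Y0_conv : forall t, 0 < t -> ex_RInt0 (Y0_integrand theta Y0) t;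
  P4_theta_Y0 : forall t, 0 < t ->
    RInt0 (Y0_integrand theta Y0) t = ln (v t / wm 0);
  P4_I0_conv : forall t, 0 < t -> ex_RInt0 (I0_integrand theta theta_y Y0) t;
  P4_I0_pos : forall t, 0 < t -> 0 < 1 + m * I0 theta theta_y Y0 t;
  P4_Y0 : forall t, 0 < t -> Y0 t = ln (1 + m * I0 theta theta_y Y0 t) / m
}.

End P4.

Section Parametric.

Variables (sigma m : R) (w wz wzz : R -> R -> R) (s : R -> R).

Definition det (z t : R) : R := wzz z t * w z t - wz z t ^ 2.

Definition theta_par (z t : R) : R :=
  (m * wz z t * w z t - sigma / 2 * w z t ^ 2) / det z t.

Definition y_par (z t : R) : R :=
  / m * ln (1 - 2 * m * wz z t / (sigma * w z t)).

(* For each t > 0, z |-> y_par z t is a bijection from [0, s(t)] onto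
   [Y0(t), Y1(t)], and theta(., t) is given on [Y0(t), Y1(t)] through it. *)
Record parametric (theta : R -> R -> R) (Y0 Y1 : R -> R) : Prop := {
  par_Y0 : forall t, 0 < t -> Y0 t = y_par 0 t;
  par_Y1 : forall t, 0 < t -> Y1 t = y_par (s t) t;
  par_range : forall z t, cl_region zero_curve s z t ->
    cl_region Y0 Y1 (y_par z t) t;
  par_onto : forall y t, cl_region Y0 Y1 y t ->
    exists! z, cl_region zero_curve s z t /\ y = y_par z t;
  par_theta : forall z t, cl_region zero_curve s z t ->
    theta (y_par z t) t = theta_par z t
}.

End Parametric.

(* Main.v *)
Require Import Defs.
From Stdlib Require Import Reals Psatz ClassicalEpsilon.
From Coquelicot Require Import Coquelicot.
Open Scope R_scope.

(** The logarithmic derivative q = w_z / w of a solution of the heat equation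
    solves the Burgers equation q_t = q_zz + 2 q q_z.  The map
    y = ln (1 - 2 m q / sigma) / m has positive z-derivative p = 1 / theta:
    that derivative has the sign of - det, which is constant on a slice by
    continuity and positive because Y0 < Y1.  So z can be expressed through
    (y, t), and the equation for theta follows from the Burgers equation by the
    chain rule.  With u = exp (m y) the integrands of I0 and I1 are the
    derivatives of - u / m along z = 0 and of u / m along z = s(t), and the
    integrand of the third boundary condition is that of ln v.

    The equation for theta involves w_zzzz and w_zzt, whose existence inside the
    region is interior regularity for the heat equation.  It is obtained from
    Bernstein's gradient estimate, a consequence of the maximum principle,
    applied to differences of difference quotients. *)

(** * Maximum principle *)

(** The boundary shapes the proof. On z = 0 and z = s(t) only one-sided z-derivatives are available,
    and w_t exists only inside. Continuity up to the boundary is expressed by projecting z onto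
    [0, s(t)] ([clamp]), and one-sided derivatives become two-sided by tangent continuation ([ext]).
    For each t, y is then an increasing bijection of the whole line, so its inverse needs no
    separate treatment at the ends. Time derivatives along the boundary curves are obtained by
    approach from inside ([lateral_derive]). At t = 0 the constant 1 in 1 + m I_i must be the limit
    of u. For z = s(t) this comes from w_z -> 0; for z = 0 it follows from q(s(t),t) <= q(0,t) <= 0.
    The gradient estimate cannot be iterated on w_z directly: calling w_z [caloric] would presuppose
    w_zzzz. Difference quotients of w satisfy the same equation with the derivatives at hand, and
    their linear rate in h gives both existence and continuity of w_zzzz. *)

Lemma is_derive_eps (f : R -> R) (x l : R) :
  is_derive f x l <->
  forall eps, 0 < eps -> exists d, 0 < d /\ forall y, Rabs (y - x) < d ->
    Rabs (f y - f x - l * (y - x)) <= eps * Rabs (y - x).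
Proof.
  split.
  - intros [_ H] eps he.
    assert (hx : is_filter_lim (locally x) x) by (intros P HP; exact HP).
    destruct (H x hx (mkposreal eps he)) as [d Hd].
    exists d; split; [apply cond_pos|]; intros y hy.
    specialize (Hd y hy). simpl in Hd.
    replace (l * (y - x)) with (scal (minus y x) l)
      by (unfold scal, minus, plus, opp; simpl; unfold mult; simpl; ring).
    exact Hd.
  - intros H. split; [apply is_linear_scal_l|].
    intros x' hx'. apply (@is_filter_lim_locally_unique R_AbsRing R_NormedModule) in hx'. subst x'.
    intros eps. destruct (H eps (cond_pos eps)) as [d [hd Hd]].
    exists (mkposreal d hd); intros y hy. specialize (Hd y hy).
    replace (l * (y - x)) with (scal (minus y x) l) in Hd
      by (unfold scal, minus, plus, opp; simpl; unfold mult; simpl; ring).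
    exact Hd.
Qed.

Lemma is_derive_continuity_pt (f : R -> R) (x l : R) :
  is_derive f x l -> continuity_pt f x.
Proof.
  intros H. apply continuity_pt_filterlim.
  apply (ex_derive_continuous f). now exists l.
Qed.

Lemma MVT_between (f df : R -> R) (a b : R) :
  (forall x, Rmin a b <= x <= Rmax a b -> is_derive f x (df x)) ->
  exists c, Rmin a b <= c <= Rmax a b /\ f b - f a = df c * (b - a).
Proof.
  intros H. apply (MVT_gen f a b df).
  - intros x hx. apply H. lra.
  - intros x hx. eapply is_derive_continuity_pt, H, hx.
Qed.

Lemma continuity_2d_pt_fst_slice (f : R -> R -> R) (x y : R) :
  continuity_2d_pt f x y -> continuity_pt (fun u => f u y) x.
Proof.
  intros H eps he. destruct (H (mkposreal eps he)) as [d Hd].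
  exists d; split; [apply cond_pos|]. intros u [_ hu]. apply Hd; [exact hu|].
  rewrite Rminus_diag, Rabs_R0; apply cond_pos.
Qed.

(** Two nested one-dimensional extreme value theorems. The chosen maximizer [g y] may jump, but the
    value [f (g y) (cl y)] is continuous in y because f is uniformly continuous on the rectangle. *)
Lemma rectangle_max (f : R -> R -> R) (a b c d : R) :
  a <= b -> c <= d ->
  (forall x y, a <= x <= b -> c <= y <= d -> continuity_2d_pt f x y) ->
  exists x0 y0, a <= x0 <= b /\ c <= y0 <= d /\
    forall x y, a <= x <= b -> c <= y <= d -> f x y <= f x0 y0.
Proof.
  intros hab hcd hf.
  (* clamping y makes the partial maximum continuous on both sides of c and d *)
  pose (cl := fun y => Rmax c (Rmin y d)).
  assert (hcl : forall y, c <= cl y <= d).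
  { intros y; unfold cl, Rmax, Rmin; repeat destruct Rle_dec; lra. }
  assert (hmax : forall y, exists x, a <= x <= b /\
            forall x', a <= x' <= b -> f x' (cl y) <= f x (cl y)).
  { intros y.
    destruct (continuity_ab_maj (fun x => f x (cl y)) a b hab) as [x [h1 h2]].
    - intros x hx. apply continuity_2d_pt_fst_slice, hf; auto.
    - exists x; auto. }
  pose (g := fun y => proj1_sig (constructive_indefinite_description _ (hmax y))).
  assert (hg : forall y, a <= g y <= b /\
            forall x', a <= x' <= b -> f x' (cl y) <= f (g y) (cl y)).
  { intros y. unfold g. now destruct constructive_indefinite_description. }
  destruct (continuity_ab_maj (fun y => f (g y) (cl y)) c d hcd) as [y0 [h1 h2]].
  - intros y hy eps he.
    destruct (uniform_continuity_2d f a b c d hf (mkposreal eps he)) as [r Hr].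
    exists r; split; [apply cond_pos|]. intros y' [_ hy']. simpl in hy'.
    simpl; unfold R_dist in *.
    assert (hd : Rabs (cl y' - cl y) < r).
    { eapply Rle_lt_trans; [|exact hy'].
      unfold cl, Rmax, Rmin, Rabs; repeat destruct Rle_dec; repeat destruct Rcase_abs; lra. }
    assert (h0 : forall x, Rabs (x - x) < r).
    { intros x; rewrite Rminus_diag, Rabs_R0; apply cond_pos. }
    destruct (hg y) as [hgy Hgy], (hg y') as [hgy' Hgy'].
    assert (e1 := Hr (g y) (cl y) (g y) (cl y') hgy (hcl y) hgy (hcl y') (h0 _) hd).
    assert (e2 := Hr (g y') (cl y) (g y') (cl y') hgy' (hcl y) hgy' (hcl y') (h0 _) hd).
    simpl in e1, e2. specialize (Hgy _ hgy'). specialize (Hgy' _ hgy).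
    apply Rabs_def2 in e1, e2. apply Rabs_def1; lra.
  - exists (g y0), (cl y0). split; [apply hg|]. split; [apply hcl|].
    intros x y hx hy.
    assert (e : cl y = y) by (unfold cl, Rmax, Rmin; repeat destruct Rle_dec; lra).
    specialize (h1 y hy). simpl in h1.
    assert (h3 := proj2 (hg y) x hx). rewrite e in *. lra.
Qed.

Lemma local_max_derive2 (f f1 : R -> R) (x l r : R) :
  0 < r ->
  (forall y, Rabs (y - x) < r -> is_derive f y (f1 y)) ->
  is_derive f1 x l ->
  (forall y, Rabs (y - x) < r -> f y <= f x) -> l <= 0.
Proof.
  intros hr hf hf1 hmax.
  assert (h0 : f1 x = 0).
  { assert (h := hf x ltac:(rewrite Rminus_diag, Rabs_R0; lra)).
    rewrite is_derive_eps in h.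
    destruct (Req_dec (f1 x) 0) as [e|ne]; [exact e|exfalso].
    assert (hp : 0 < Rabs (f1 x)) by now apply Rabs_pos_lt.
    destruct (h (Rabs (f1 x) / 2) ltac:(lra)) as [d [hd Hd]].
    assert (hm : 0 < Rmin d r) by now apply Rmin_pos.
    assert (hm1 := Rmin_l d r). assert (hm2 := Rmin_r d r).
    set (k := Rmin d r / 2) in *. assert (hk : 0 < k) by (unfold k; lra).
    destruct (Rle_dec 0 (f1 x)) as [hs|hs].
    - rewrite (Rabs_pos_eq (f1 x)) in * by lra.
      assert (e : Rabs (x + k - x) = k) by (replace (x + k - x) with k by ring; apply Rabs_pos_eq; lra).
      assert (m1 := Hd (x + k) ltac:(rewrite e; unfold k; lra)).
      assert (m2 := hmax (x + k) ltac:(rewrite e; unfold k; lra)).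
      rewrite e in m1. replace (x + k - x) with k in m1 by ring.
      apply Rabs_le_between in m1. nra.
    - rewrite (Rabs_left (f1 x)) in * by lra.
      assert (e : Rabs (x - k - x) = k) by (replace (x - k - x) with (- k) by ring; rewrite Rabs_Ropp; apply Rabs_pos_eq; lra).
      assert (m1 := Hd (x - k) ltac:(rewrite e; unfold k; lra)).
      assert (m2 := hmax (x - k) ltac:(rewrite e; unfold k; lra)).
      rewrite e in m1. replace (x - k - x) with (- k) in m1 by ring.
      apply Rabs_le_between in m1. nra. }
  (* Since [f1 x = 0], a positive l would make f1 positive just to the right of x, and f would
     exceed its maximum at x + k. *)
  destruct (Rle_dec l 0) as [h|h]; [exact h|exfalso].
  rewrite is_derive_eps in hf1. destruct (hf1 (l / 2) ltac:(lra)) as [d [hd Hd]].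
  assert (hm : 0 < Rmin d r) by now apply Rmin_pos.
  assert (hm1 := Rmin_l d r). assert (hm2 := Rmin_r d r).
  set (k := Rmin d r / 2) in *. assert (hk : 0 < k) by (unfold k; lra).
  destruct (MVT_cor2 f f1 x (x + k)) as [c [e hc]]; [lra| |].
  { intros c hc. apply is_derive_Reals, hf. rewrite Rabs_pos_eq; unfold k in *; lra. }
  assert (m1 := Hd c ltac:(rewrite Rabs_pos_eq; unfold k in *; lra)).
  assert (m2 := hmax (x + k) ltac:(replace (x + k - x) with k by ring; rewrite Rabs_pos_eq; unfold k; lra)).
  rewrite h0 in m1. rewrite (Rabs_pos_eq (c - x)) in m1 by lra.
  apply Rabs_le_between in m1.
  assert (0 < f1 c) by nra. nra.
Qed.

(** One-sided on purpose: the maximum in [parabolic_max_strict] may lie on the top edge t = d, where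
    only earlier times can be compared. *)
Lemma left_max_derive (f : R -> R) (x l r : R) :
  0 < r -> is_derive f x l ->
  (forall y, x - r < y < x -> f y <= f x) -> 0 <= l.
Proof.
  intros hr hf hmax. destruct (Rle_dec 0 l) as [h|h]; [exact h|exfalso].
  rewrite is_derive_eps in hf. destruct (hf (- l / 2) ltac:(lra)) as [d [hd Hd]].
  assert (hm : 0 < Rmin d r) by now apply Rmin_pos.
  assert (hm1 := Rmin_l d r). assert (hm2 := Rmin_r d r).
  set (k := Rmin d r / 2) in *. assert (hk : 0 < k) by (unfold k; lra).
  assert (e : Rabs (x - k - x) = k) by (replace (x - k - x) with (- k) by ring; rewrite Rabs_Ropp; apply Rabs_pos_eq; lra).
  assert (m1 := Hd (x - k) ltac:(rewrite e; unfold k; lra)).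
  assert (m2 := hmax (x - k) ltac:(unfold k in *; lra)).
  rewrite e in m1. replace (x - k - x) with (- k) in m1 by ring.
  apply Rabs_le_between in m1. nra.
Qed.

(** Only the bottom and the sides form the parabolic boundary, so the differential inequality is
    required up to t = d. A maximum elsewhere would give f2 <= 0 <= ft, against ft < f2. *)
Lemma parabolic_max_strict (f f1 f2 ft : R -> R -> R) (a b c d M : R) :
  a <= b -> c <= d ->
  (forall x t, a <= x <= b -> c <= t <= d -> continuity_2d_pt f x t) ->
  (forall x t, a < x < b -> c < t <= d ->
     is_derive (fun x' => f x' t) x (f1 x t) /\
     is_derive (fun x' => f1 x' t) x (f2 x t) /\
     is_derive (fun t' => f x t') t (ft x t) /\ ft x t < f2 x t) ->
  (forall x t, a <= x <= b -> c <= t <= d -> x = a \/ x = b \/ t = c -> f x t <= M) ->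
  forall x t, a <= x <= b -> c <= t <= d -> f x t <= M.
Proof.
  intros hab hcd hc hd hM.
  destruct (rectangle_max f a b c d hab hcd hc) as (x0 & t0 & hx0 & ht0 & hmax).
  assert (h0 : f x0 t0 <= M).
  { destruct (Req_dec x0 a) as [e|na]; [apply hM; auto|].
    destruct (Req_dec x0 b) as [e|nb]; [apply hM; auto|].
    destruct (Req_dec t0 c) as [e|nc]; [apply hM; auto|exfalso].
    destruct (hd x0 t0 ltac:(lra) ltac:(lra)) as (_ & d2 & dt & hlt).
    assert (hl : f2 x0 t0 <= 0).
    { assert (m1 := Rmin_l (x0 - a) (b - x0)). assert (m2 := Rmin_r (x0 - a) (b - x0)).
      assert (m3 : 0 < Rmin (x0 - a) (b - x0)) by (apply Rmin_pos; lra).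
      apply (local_max_derive2 (fun x => f x t0) (fun x => f1 x t0) x0 _
               (Rmin (x0 - a) (b - x0))); auto.
      - intros y hy. apply Rabs_def2 in hy. apply hd; lra.
      - intros y hy. apply Rabs_def2 in hy. apply hmax; lra. }
    assert (0 <= ft x0 t0); [|lra].
    apply (left_max_derive (fun t => f x0 t) t0 _ (t0 - c)); auto; [lra|].
    intros y hy. apply hmax; lra. }
  intros x t hx ht. specialize (hmax x t hx ht). lra.
Qed.

Lemma parabolic_max (f f1 f2 ft : R -> R -> R) (a b c d M : R) :
  a <= b -> c <= d ->
  (forall x t, a <= x <= b -> c <= t <= d -> continuity_2d_pt f x t) ->
  (forall x t, a < x < b -> c < t <= d ->
     is_derive (fun x' => f x' t) x (f1 x t) /\
     is_derive (fun x' => f1 x' t) x (f2 x t) /\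
     is_derive (fun t' => f x t') t (ft x t) /\ ft x t <= f2 x t) ->
  (forall x t, a <= x <= b -> c <= t <= d -> x = a \/ x = b \/ t = c -> f x t <= M) ->
  forall x t, a <= x <= b -> c <= t <= d -> f x t <= M.
Proof.
  intros hab hcd hc hd hM x t hx ht.
  apply le_epsilon. intros eps he.
  (* Subtracting k (t - c) makes the inequality strict at a cost of at most eps; the + 1 keeps the
     denominator positive when c = d. *)
  pose (k := eps / (d - c + 1)).
  assert (hk : 0 < k) by (apply Rdiv_lt_0_compat; lra).
  assert (hke : k * (d - c) <= eps).
  { assert (k * (d - c + 1) = eps) by (unfold k; field; lra). nra. }
  assert (h : f x t - k * (t - c) <= M).
  { apply (parabolic_max_strict (fun x t => f x t - k * (t - c)) f1 f2
             (fun x t => ft x t - k) a b c d M); auto.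
    - intros x' t' hx' ht'. apply continuity_2d_pt_minus; [now apply hc|].
      apply continuity_2d_pt_mult; [apply continuity_2d_pt_const|].
      apply continuity_2d_pt_minus;
        [apply continuity_2d_pt_id2|apply continuity_2d_pt_const].
    - intros x' t' hx' ht'. destruct (hd x' t' hx' ht') as (h1 & h2 & h3 & h4).
      split; [|split; [exact h2|split]].
      + auto_derive; [now exists (f1 x' t')|].
        rewrite (is_derive_unique (fun x : R => f x t') _ _ h1). ring.
      + auto_derive; [now exists (ft x' t')|].
        rewrite (is_derive_unique (fun t : R => f x' t) _ _ h3). ring.
      + lra.
    - intros x' t' hx' ht' hb. specialize (hM x' t' hx' ht' hb). nra. }
  assert (k * (t - c) <= k * (d - c)) by nra. lra.
Qed.

(** * Interior regularity for the heat equation *)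

Definition box (x0 t0 r x t : R) : Prop := Rabs (x - x0) <= r /\ Rabs (t - t0) <= r.

(** The heat equation is encoded by reusing [f2] as the time derivative of f and [f3] as that of f1.
    The fields are just what the maximum principle needs for a function built from f^2, f1^2 and a
    smooth cutoff. *)
Record caloric (D : R -> R -> Prop) (f f1 f2 f3 : R -> R -> R) : Prop := {
  cal_x : forall x t, D x t -> is_derive (fun x' => f x' t) x (f1 x t);
  cal_xx : forall x t, D x t -> is_derive (fun x' => f1 x' t) x (f2 x t);
  cal_xxx : forall x t, D x t -> is_derive (fun x' => f2 x' t) x (f3 x t);
  cal_t : forall x t, D x t -> is_derive (fun t' => f x t') t (f2 x t);
  cal_xt : forall x t, D x t -> is_derive (fun t' => f1 x t') t (f3 x t);
  cal_cont : forall x t, D x t -> continuity_2d_pt f x t;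
  cal_x_cont : forall x t, D x t -> continuity_2d_pt f1 x t
}.

Definition dq (h : R) (f : R -> R -> R) (x t : R) : R := (f (x + h) t - f x t) / h.

Lemma caloric_incl (D D' : R -> R -> Prop) f f1 f2 f3 :
  (forall x t, D' x t -> D x t) -> caloric D f f1 f2 f3 -> caloric D' f f1 f2 f3.
Proof. intros H [a b c d e g h]; constructor; auto. Qed.

Lemma is_derive_shift (f : R -> R) (h x l : R) :
  is_derive f (x + h) l -> is_derive (fun x' => f (x' + h)) x l.
Proof.
  intros H. replace l with (1 * l) by ring.
  apply (is_derive_comp f (fun x' => x' + h)); [exact H|].
  auto_derive; auto; ring.
Qed.

Lemma is_derive_diff (f g : R -> R) (x l k : R) :
  is_derive f x l -> is_derive g x k -> is_derive (fun x' => f x' - g x') x (l - k).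
Proof. intros Hf Hg. exact (is_derive_minus f g x l k Hf Hg). Qed.

Lemma is_derive_quotient (f g : R -> R) (h x l k : R) :
  is_derive f x l -> is_derive g x k ->
  is_derive (fun x' => (f x' - g x') / h) x ((l - k) / h).
Proof.
  intros Hf Hg.
  apply (is_derive_ext (fun x' => / h * (f x' - g x'))).
  { intros y; unfold Rdiv; apply Rmult_comm. }
  replace ((l - k) / h) with (/ h * (l - k)) by (unfold Rdiv; ring).
  apply (is_derive_scal (fun x' => f x' - g x')).
  exact (is_derive_minus f g x l k Hf Hg).
Qed.

Lemma continuity_2d_pt_dq (h : R) (f : R -> R -> R) (x t : R) :
  continuity_2d_pt f x t -> continuity_2d_pt f (x + h) t ->
  continuity_2d_pt (dq h f) x t.
Proof.
  intros H1 H2. apply continuity_2d_pt_mult; [|apply continuity_2d_pt_const].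
  apply continuity_2d_pt_minus; [|exact H1].
  intros eps. destruct (H2 eps) as [d Hd]. exists d. intros u v hu hv.
  apply Hd; [|exact hv]. now replace (u + h - (x + h)) with (u - x) by ring.
Qed.

Lemma caloric_dq (D : R -> R -> Prop) (h : R) f f1 f2 f3 :
  caloric D f f1 f2 f3 ->
  caloric (fun x t => D x t /\ D (x + h) t) (dq h f) (dq h f1) (dq h f2) (dq h f3).
Proof.
  intros [c1 c2 c3 c4 c5 c6 c7]; constructor; intros x t [h1 h2].
  - apply is_derive_quotient; [apply (is_derive_shift (fun a => f a t))|]; now apply c1.
  - apply is_derive_quotient; [apply (is_derive_shift (fun a => f1 a t))|]; now apply c2.
  - apply is_derive_quotient; [apply (is_derive_shift (fun a => f2 a t))|]; now apply c3.
  - apply is_derive_quotient; now apply c4.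
  - apply is_derive_quotient; now apply c5.
  - apply continuity_2d_pt_dq; now apply c6.
  - apply continuity_2d_pt_dq; now apply c7.
Qed.

Lemma caloric_minus (D : R -> R -> Prop) f f1 f2 f3 g g1 g2 g3 :
  caloric D f f1 f2 f3 -> caloric D g g1 g2 g3 ->
  caloric D (fun x t => f x t - g x t) (fun x t => f1 x t - g1 x t)
    (fun x t => f2 x t - g2 x t) (fun x t => f3 x t - g3 x t).
Proof.
  intros [c1 c2 c3 c4 c5 c6 c7] [d1 d2 d3 d4 d5 d6 d7].
  constructor; intros x t hD.
  - now apply is_derive_diff; [apply c1|apply d1].
  - now apply is_derive_diff; [apply c2|apply d2].
  - now apply is_derive_diff; [apply c3|apply d3].
  - now apply is_derive_diff; [apply c4|apply d4].
  - now apply is_derive_diff; [apply c5|apply d5].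
  - now apply continuity_2d_pt_minus; [apply c6|apply d6].
  - now apply continuity_2d_pt_minus; [apply c7|apply d7].
Qed.

Lemma dq_le (f f1 : R -> R -> R) (x0 t0 r r' h M : R) :
  h <> 0 -> r' + Rabs h <= r ->
  (forall x t, box x0 t0 r x t -> is_derive (fun x' => f x' t) x (f1 x t)) ->
  (forall x t, box x0 t0 r x t -> Rabs (f1 x t) <= M) ->
  forall x t, box x0 t0 r' x t -> Rabs (dq h f x t) <= M.
Proof.
  intros hh hr hf hM x t [hx ht].
  assert (hb : forall c, Rmin x (x + h) <= c <= Rmax x (x + h) -> box x0 t0 r c t).
  { assert (h1 := Rabs_pos h). intros c hc. split; [|lra].
    apply Rabs_le_between. apply Rabs_le_between in hx.
    unfold Rmin, Rmax, Rabs in *; repeat destruct Rle_dec; repeat destruct Rcase_abs; lra. }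
  destruct (MVT_between (fun x => f x t) (fun x => f1 x t) x (x + h)) as [c [hc e]].
  { intros c hc. apply hf, hb, hc. }
  unfold dq. rewrite e. replace (f1 c t * (x + h - x) / h) with (f1 c t) by (field; auto).
  apply hM, hb, hc.
Qed.

Lemma derive_le_of_dq (f : R -> R) (x l M d : R) :
  is_derive f x l -> 0 < d ->
  (forall h, h <> 0 -> Rabs h < d -> Rabs ((f (x + h) - f x) / h) <= M) ->
  Rabs l <= M.
Proof.
  intros Hf hd H. apply le_epsilon. intros eps he.
  rewrite is_derive_eps in Hf. destruct (Hf eps he) as [d' [hd' Hd]].
  assert (m1 := Rmin_l d d'). assert (m2 := Rmin_r d d').
  assert (m3 : 0 < Rmin d d') by now apply Rmin_pos.
  set (h := Rmin d d' / 2). assert (hh : 0 < h) by (unfold h; lra).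
  assert (e : Rabs h = h) by (apply Rabs_pos_eq; lra).
  specialize (H h ltac:(lra) ltac:(rewrite e; unfold h; lra)).
  specialize (Hd (x + h)). replace (x + h - x) with h in Hd by ring.
  specialize (Hd ltac:(rewrite e; unfold h; lra)). rewrite e in Hd.
  replace l with ((f (x + h) - f x) / h - (f (x + h) - f x - l * h) * / h) by (field; lra).
  eapply Rle_trans; [apply Rabs_triang|]. rewrite Rabs_Ropp.
  apply Rplus_le_compat; [exact H|].
  rewrite Rabs_mult, (Rabs_pos_eq (/ h)) by (left; now apply Rinv_0_lt_compat).
  apply (Rmult_le_reg_r h); [lra|]. rewrite Rmult_assoc, Rinv_l by lra. lra.
Qed.

(* Bernstein's method: with the cutoff eta, which vanishes on the parabolic
   boundary of the box, eta^2 f_x^2 + A f^2 is a subsolution of the heat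
   equation as soon as A >= eta eta_t + 3 eta_x^2 - eta eta_xx. *)
Lemma bernstein (x0 t0 r r' : R) :
  0 < r' < r -> exists K, 0 <= K /\ forall f f1 f2 f3 M,
  caloric (box x0 t0 r) f f1 f2 f3 ->
  (forall x t, box x0 t0 r x t -> Rabs (f x t) <= M) ->
  forall x t, box x0 t0 r' x t -> Rabs (f1 x t) <= K * M.
Proof.
  intros hr.
  (* The cutoff is eta = X T, with 0 <= X <= r^2 and 0 <= T <= 2 r. The three terms of the threshold
     for A are bounded by 2 r^5 (eta eta_t), 48 r^4 (3 eta_x^2) and 8 r^4 (- eta eta_xx). *)
  pose (A := 2 * r ^ 5 + 56 * r ^ 4).
  assert (hA : 0 < A) by (unfold A; assert (0 < r ^ 5) by (apply pow_lt; lra);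
                       assert (0 < r ^ 4) by (apply pow_lt; lra); lra).
  (* Lower bound of the cutoff on the smaller box: X >= r^2 - r'^2 and T >= r - r'. *)
  pose (e0 := (r ^ 2 - r' ^ 2) * (r - r')).
  assert (he0 : 0 < e0) by (unfold e0; apply Rmult_lt_0_compat; nra).
  exists (sqrt A / e0). split.
  { apply Rmult_le_pos; [apply sqrt_pos|left; now apply Rinv_0_lt_compat]. }
  intros f f1 f2 f3 M Hc HM.
  assert (hM : 0 <= M).
  { eapply Rle_trans; [apply Rabs_pos|apply (HM x0 t0)].
    split; rewrite Rminus_diag, Rabs_R0; lra. }
  pose (X := fun x => r ^ 2 - (x - x0) ^ 2).
  pose (T := fun t => t - t0 + r).
  assert (main : forall x t, x0 - r <= x <= x0 + r -> t0 - r <= t <= t0 + r ->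
     (X x * T t) ^ 2 * f1 x t ^ 2 + A * f x t ^ 2 <= A * M ^ 2).
  { assert (hbox : forall x t, x0 - r <= x <= x0 + r -> t0 - r <= t <= t0 + r -> box x0 t0 r x t).
    { intros x t hx ht; split; apply Rabs_le_between; lra. }
    apply (parabolic_max
      (fun x t => (X x * T t) ^ 2 * f1 x t ^ 2 + A * f x t ^ 2)
      (fun x t => - 4 * (x - x0) * T t * (X x * T t) * f1 x t ^ 2
                  + 2 * (X x * T t) ^ 2 * f1 x t * f2 x t + 2 * A * f x t * f1 x t)
      (fun x t => - 4 * T t * (X x * T t) * f1 x t ^ 2
                  + 8 * (x - x0) ^ 2 * T t ^ 2 * f1 x t ^ 2
                  - 16 * (x - x0) * T t * (X x * T t) * f1 x t * f2 x t
                  + 2 * (X x * T t) ^ 2 * (f2 x t ^ 2 + f1 x t * f3 x t)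
                  + 2 * A * (f1 x t ^ 2 + f x t * f2 x t))
      (fun x t => 2 * X x * (X x * T t) * f1 x t ^ 2
                  + 2 * (X x * T t) ^ 2 * f1 x t * f3 x t + 2 * A * f x t * f2 x t));
      [lra|lra| | |].
    - intros x t hx ht. specialize (hbox x t hx ht).
      assert (cf := cal_cont _ _ _ _ _ Hc x t hbox).
      assert (cf1 := cal_x_cont _ _ _ _ _ Hc x t hbox).
      unfold X, T. simpl.
      repeat first [exact cf | exact cf1 | apply continuity_2d_pt_plus
        | apply continuity_2d_pt_opp | apply continuity_2d_pt_mult
        | apply continuity_2d_pt_const | apply continuity_2d_pt_id1
        | apply continuity_2d_pt_id2].
    - intros x t hx ht. specialize (hbox x t ltac:(lra) ltac:(lra)).
      assert (d1 := cal_x _ _ _ _ _ Hc x t hbox).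
      assert (d2 := cal_xx _ _ _ _ _ Hc x t hbox).
      assert (d3 := cal_xxx _ _ _ _ _ Hc x t hbox).
      assert (d4 := cal_t _ _ _ _ _ Hc x t hbox).
      assert (d5 := cal_xt _ _ _ _ _ Hc x t hbox).
      split; [|split; [|split]].
      + unfold X.  auto_derive; [repeat split; eexists; eassumption|].
        rewrite (is_derive_unique (fun x : R => f x t) _ _ d1),
          (is_derive_unique (fun x : R => f1 x t) _ _ d2). ring.
      + unfold X. auto_derive; [repeat split; eexists; eassumption|].
        rewrite (is_derive_unique (fun x : R => f x t) _ _ d1),
          (is_derive_unique (fun x : R => f1 x t) _ _ d2),
          (is_derive_unique (fun x : R => f2 x t) _ _ d3). ring.
      + unfold T. auto_derive; [repeat split; eexists; eassumption|].
        rewrite (is_derive_unique (fun t : R => f x t) _ _ d4),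
          (is_derive_unique (fun t : R => f1 x t) _ _ d5). ring.
      + set (xi := x - x0). set (tau := T t).
        assert (htau : 0 < tau <= 2 * r) by (unfold tau, T; lra).
        assert (hxi : xi ^ 2 <= r ^ 2).
        { unfold xi. assert (- r <= x - x0 <= r) by lra. nra. }
        assert (hX : 0 <= X x <= r ^ 2) by (unfold X; fold xi; nra).
        set (q := X x) in *.
        assert (a1 : q * q * tau <= 2 * r ^ 5).
        { assert (q * q <= r ^ 2 * r ^ 2) by (apply Rmult_le_compat; lra).
          replace (2 * r ^ 5) with (r ^ 2 * r ^ 2 * (2 * r)) by ring.
          apply Rmult_le_compat; nra. }
        assert (ht2 : tau ^ 2 <= 4 * r ^ 2) by nra.
        assert (a2 : xi ^ 2 * tau ^ 2 <= 4 * r ^ 4).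
        { replace (4 * r ^ 4) with (r ^ 2 * (4 * r ^ 2)) by ring.
          apply Rmult_le_compat; nra. }
        assert (a3 : tau ^ 2 * q <= 4 * r ^ 4).
        { replace (4 * r ^ 4) with (4 * r ^ 2 * r ^ 2) by ring.
          apply Rmult_le_compat; nra. }
        assert (hA' : q * q * tau + 12 * (xi ^ 2 * tau ^ 2) + 2 * (tau ^ 2 * q) <= A)
          by (unfold A; lra).
        (* The second space derivative minus the time derivative is twice this square plus twice the
           product in [s2]. Completing the square absorbs the mixed term in f1 f2, which turns + 4
           xi^2 tau^2 into the - 12 xi^2 tau^2 of [s2]. *)
        assert (s1 := pow2_ge_0 (q * tau * f2 x t - 4 * xi * tau * f1 x t)).
        assert (s2 : 0 <= (A - (q * q * tau + 12 * (xi ^ 2 * tau ^ 2) + 2 * (tau ^ 2 * q))) * f1 x t ^ 2)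
          by (apply Rmult_le_pos; [lra|apply pow2_ge_0]).
        nra.
    - intros x t hx ht hb.
      assert (e : X x * T t = 0).
      { unfold X, T. destruct hb as [e|[e|e]]; subst; ring. }
      rewrite e. assert (h := HM x t (hbox x t hx ht)).
      assert (f x t ^ 2 <= M ^ 2).
      { rewrite <- (pow2_abs (f x t)). apply pow_incr. split; [apply Rabs_pos|exact h]. }
      nra. }
  intros x t [hx ht]. apply Rabs_le_between in hx, ht.
  specialize (main x t ltac:(lra) ltac:(lra)).
  assert (hXT : e0 <= X x * T t).
  { unfold e0, X, T. apply Rmult_le_compat; nra. }
  assert (h2 : (e0 * f1 x t) ^ 2 <= A * M ^ 2).
  { assert (e0 ^ 2 <= (X x * T t) ^ 2) by (apply pow_incr; lra).
    assert (p1 := pow2_ge_0 (f1 x t)). assert (p2 := pow2_ge_0 (f x t)).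
    assert (0 <= A * f x t ^ 2) by nra. nra. }
  assert (h3 : Rabs (e0 * f1 x t) <= sqrt A * M).
  { apply Rabs_le_between. rewrite <- (sqrt_sqrt A) in h2 by lra.
    assert (p := sqrt_pos A). set (sA := sqrt A) in *.
    assert (0 <= sA * M) by nra.
    split; apply Rnot_lt_le; intros hn; nra. }
  rewrite Rabs_mult, (Rabs_pos_eq e0) in h3 by lra.
  apply (Rmult_le_reg_l e0); [exact he0|].
  replace (e0 * (sqrt A / e0 * M)) with (sqrt A * M) by (field; lra). exact h3.
Qed.

Lemma box_le x0 t0 r r' x t : r' <= r -> box x0 t0 r' x t -> box x0 t0 r x t.
Proof. intros h [h1 h2]; split; lra. Qed.

Lemma box_shift x0 t0 r r' h x t : r' + Rabs h <= r ->
  box x0 t0 r' x t -> box x0 t0 r x t /\ box x0 t0 r (x + h) t.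
Proof.
  intros hr [h1 h2]. assert (h0 := Rabs_pos h). repeat split; try lra.
  replace (x + h - x0) with ((x - x0) + h) by ring.
  eapply Rle_trans; [apply Rabs_triang|lra].
Qed.

(** Formally this is [bernstein] for f1, but a [caloric] structure on f1 would need a fourth
    derivative of f. The estimate is applied to the difference quotients of f, which are bounded by
    the bound on f1, and h tends to 0. [bernstein_xxx] repeats the argument one order higher. *)
Lemma bernstein_xx (x0 t0 r r' : R) :
  0 < r' < r -> exists K, 0 <= K /\ forall f f1 f2 f3 M,
  caloric (box x0 t0 r) f f1 f2 f3 ->
  (forall x t, box x0 t0 r x t -> Rabs (f1 x t) <= M) ->
  forall x t, box x0 t0 r' x t -> Rabs (f2 x t) <= K * M.
Proof.
  intros hr. set (m := (r + r') / 2).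
  destruct (bernstein x0 t0 m r') as [K [hK H]]; [unfold m; lra|].
  exists K; split; [exact hK|]. intros f f1 f2 f3 M Hc HM x t hb.
  apply (derive_le_of_dq (fun x => f1 x t) x _ _ ((r - r') / 2)); [|lra|].
  { apply Hc. apply (box_le _ _ r r'); [lra|auto]. }
  intros h hh hlt. apply (H (dq h f) (dq h f1) (dq h f2) (dq h f3)); auto.
  - eapply caloric_incl; [|apply caloric_dq, Hc]. simpl.
    intros x' t' hb'. apply (box_shift _ _ r m); [unfold m; lra|auto].
  - apply (dq_le f f1 x0 t0 r); auto; [unfold m; lra|apply Hc].
Qed.

Lemma bernstein_xxx (x0 t0 r r' : R) :
  0 < r' < r -> exists K, 0 <= K /\ forall f f1 f2 f3 M,
  caloric (box x0 t0 r) f f1 f2 f3 ->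
  (forall x t, box x0 t0 r x t -> Rabs (f2 x t) <= M) ->
  forall x t, box x0 t0 r' x t -> Rabs (f3 x t) <= K * M.
Proof.
  intros hr. set (m := (r + r') / 2).
  destruct (bernstein_xx x0 t0 m r') as [K [hK H]]; [unfold m; lra|].
  exists K; split; [exact hK|]. intros f f1 f2 f3 M Hc HM x t hb.
  apply (derive_le_of_dq (fun x => f2 x t) x _ _ ((r - r') / 2)); [|lra|].
  { apply Hc. apply (box_le _ _ r r'); [lra|auto]. }
  intros h hh hlt. apply (H (dq h f) (dq h f1) (dq h f2) (dq h f3)); auto.
  - eapply caloric_incl; [|apply caloric_dq, Hc]. simpl.
    intros x' t' hb'. apply (box_shift _ _ r m); [unfold m; lra|auto].
  - apply (dq_le f1 f2 x0 t0 r); auto; [unfold m; lra|apply Hc].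
Qed.

Lemma caloric_xxx_le (x0 t0 r r' : R) :
  0 < r' < r -> exists K, 0 <= K /\ forall f f1 f2 f3 M,
  caloric (box x0 t0 r) f f1 f2 f3 ->
  (forall x t, box x0 t0 r x t -> Rabs (f x t) <= M) ->
  forall x t, box x0 t0 r' x t -> Rabs (f3 x t) <= K * M.
Proof.
  (* Each of the three derivatives costs one third of the gap between the boxes. *)
  intros hr. set (d := (r - r') / 3).
  destruct (bernstein x0 t0 r (r - d)) as [K1 [hK1 H1]]; [unfold d; lra|].
  destruct (bernstein_xx x0 t0 (r - d) (r' + d)) as [K2 [hK2 H2]]; [unfold d; lra|].
  destruct (bernstein_xxx x0 t0 (r' + d) r') as [K3 [hK3 H3]]; [unfold d; lra|].
  exists (K3 * (K2 * K1)). split; [repeat apply Rmult_le_pos; auto|].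
  intros f f1 f2 f3 M Hc HM.
  replace (K3 * (K2 * K1) * M) with (K3 * (K2 * (K1 * M))) by ring.
  assert (Hc2 : caloric (box x0 t0 (r - d)) f f1 f2 f3).
  { eapply caloric_incl; [|exact Hc]. intros x t; apply box_le; unfold d; lra. }
  assert (Hc3 : caloric (box x0 t0 (r' + d)) f f1 f2 f3).
  { eapply caloric_incl; [|exact Hc]. intros x t; apply box_le; unfold d; lra. }
  apply (H3 f f1 f2 f3); auto. apply (H2 f f1 f2 f3); auto. apply (H1 f f1 f2 f3); auto.
Qed.

Lemma box_bounded (x0 t0 r : R) (f : R -> R -> R) :
  0 <= r -> (forall x t, box x0 t0 r x t -> continuity_2d_pt f x t) ->
  exists C, 0 <= C /\ forall x t, box x0 t0 r x t -> Rabs (f x t) <= C.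
Proof.
  intros hr hf.
  destruct (rectangle_max (fun x t => Rabs (f x t)) (x0 - r) (x0 + r) (t0 - r) (t0 + r))
    as (a & b & ha & hb & H); [lra|lra| |].
  - intros x t hx ht. apply continuity_1d_2d_pt_comp; [apply Rcontinuity_abs|].
    apply hf. split; apply Rabs_le_between; lra.
  - exists (Rabs (f a b)); split; [apply Rabs_pos|]. intros x t [hx ht].
    apply Rabs_le_between in hx, ht. apply H; lra.
Qed.

(* The estimate is applied to differences of difference quotients, which
   therefore form Cauchy families together with their third derivatives. *)
Lemma caloric_dq_cauchy (x0 t0 r : R) f f1 f2 f3 :
  0 < r -> caloric (box x0 t0 r) f f1 f2 f3 ->
  (forall x t, box x0 t0 r x t -> continuity_2d_pt f2 x t) ->
  exists d K, 0 < d /\ 0 <= K /\ forall h k x t,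
    h <> 0 -> k <> 0 -> Rabs h <= d -> Rabs k <= d -> box x0 t0 d x t ->
    Rabs (dq h f3 x t - dq k f3 x t) <= K * (Rabs h + Rabs k).
Proof.
  intros hr Hc hcont. destruct (box_bounded x0 t0 r f2) as [C [hC HC]]; [lra|auto|].
  destruct (caloric_xxx_le x0 t0 (2 * r / 3) (r / 3)) as [K [hK H]]; [lra|].
  exists (r / 3), (K * C). split; [lra|]. split; [now apply Rmult_le_pos|].
  intros h k x t hh hk hhr hkr hb.
  replace (K * C * (Rabs h + Rabs k)) with (K * (C * (Rabs h + Rabs k))) by ring.
  assert (Hd : forall h, Rabs h <= r / 3 ->
    caloric (box x0 t0 (2 * r / 3)) (dq h f) (dq h f1) (dq h f2) (dq h f3)).
  { intros l hl. eapply caloric_incl; [|apply caloric_dq, Hc]. simpl.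
    intros x' t' hb'. apply (box_shift _ _ r (2 * r / 3)); [lra|auto]. }
  (* Two applications of the mean value theorem: the quotient equals f1 at a point within |h| of x,
     and f1 varies there at rate at most C, the bound on f2. *)
  assert (He : forall h x t, h <> 0 -> Rabs h <= r / 3 -> box x0 t0 (2 * r / 3) x t ->
    Rabs (dq h f x t - f1 x t) <= C * Rabs h).
  { clear h k x t hh hk hhr hkr hb. intros h x t hh hhr hb.
    assert (h0 := Rabs_pos h). assert (hb' := hb). destruct hb' as [hx ht].
    assert (hbb : forall c, Rmin x (x + h) <= c <= Rmax x (x + h) ->
       box x0 t0 r c t /\ Rabs (c - x) <= Rabs h).
    { intros c hc. split; [split; [|lra]|].
      - apply Rabs_le_between. apply Rabs_le_between in hx.
        unfold Rmin, Rmax, Rabs in *; repeat destruct Rle_dec; repeat destruct Rcase_abs; lra.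
      - unfold Rmin, Rmax, Rabs in *; repeat destruct Rle_dec; repeat destruct Rcase_abs; lra. }
    destruct (MVT_between (fun x => f x t) (fun x => f1 x t) x (x + h)) as [c [hc e]].
    { intros c hc. apply Hc, hbb, hc. }
    unfold dq. rewrite e. replace (f1 c t * (x + h - x) / h) with (f1 c t) by (field; auto).
    destruct (MVT_between (fun x => f1 x t) (fun x => f2 x t) x c) as [c' [hc' e']].
    { intros c' hc'. apply Hc, hbb.
      unfold Rmin, Rmax in *; repeat destruct Rle_dec; lra. }
    rewrite e', Rabs_mult. apply Rmult_le_compat; try apply Rabs_pos; [|now apply hbb].
    apply HC, hbb. unfold Rmin, Rmax in *; repeat destruct Rle_dec; lra. }
  apply (H _ _ _ _ _ (caloric_minus _ _ _ _ _ _ _ _ _ (Hd h hhr) (Hd k hkr))); auto.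
  clear x t hb. intros x t hb.
  replace (dq h f x t - dq k f x t)
    with ((dq h f x t - f1 x t) + - (dq k f x t - f1 x t)) by ring.
  eapply Rle_trans; [apply Rabs_triang|]. rewrite Rabs_Ropp, Rmult_plus_distr_l.
  apply Rplus_le_compat; auto.
Qed.

(** Completeness gives the limit along the steps d / (n + 1), and the Cauchy bound extends it to all
    h. The rate K |h| is kept in the conclusion: since K does not depend on the point, it later
    gives uniform convergence of the quotients. *)
Lemma cauchy_dq_derive (f : R -> R) (x d K : R) :
  0 < d -> 0 <= K ->
  (forall h k, h <> 0 -> k <> 0 -> Rabs h <= d -> Rabs k <= d ->
     Rabs ((f (x + h) - f x) / h - (f (x + k) - f x) / k) <= K * (Rabs h + Rabs k)) ->
  exists l, is_derive f x l /\ forall h, h <> 0 -> Rabs h <= d ->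
    Rabs ((f (x + h) - f x) / h - l) <= K * Rabs h.
Proof.
  intros hd hK H.
  pose (hn := fun n => d * / (INR n + 1)).
  assert (hinv : forall n, 0 < / (INR n + 1) <= 1).
  { intros n. assert (hn0 := pos_INR n). split; [apply Rinv_0_lt_compat; lra|].
    rewrite <- Rinv_1. apply Rinv_le_contravar; lra. }
  assert (hn1 : forall n, 0 < hn n <= d) by (intros n; specialize (hinv n); unfold hn; nra).
  pose (u := fun n => (f (x + hn n) - f x) / hn n).
  assert (hl : is_lim_seq hn 0).
  { replace (Finite 0) with (Rbar_mult d 0) by (simpl; f_equal; ring).
    apply is_lim_seq_scal_l.
    apply (is_lim_seq_ext (fun n => / INR (S n))).
    { intros n; now rewrite S_INR. }
    apply (is_lim_seq_incr_1 (fun n => / INR n)).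
    replace (Finite 0) with (Rbar_inv p_infty) by reflexivity.
    apply is_lim_seq_inv; [apply is_lim_seq_INR|easy]. }
  assert (hs : forall eps, 0 < eps -> exists N, forall n, (N <= n)%nat -> hn n < eps).
  { intros eps he. apply is_lim_seq_spec in hl.
    destruct (hl (mkposreal eps he)) as [N HN]. exists N. intros n hN.
    specialize (HN n hN). simpl in HN. rewrite Rminus_0_r in HN.
    apply Rabs_def2 in HN; lra. }
  assert (hu : ex_finite_lim_seq u).
  { apply ex_lim_seq_cauchy_corr. intros eps.
    (* Dividing by 2 K + 1 and not by 2 K covers K = 0. *)
    destruct (hs (eps / (2 * K + 1))) as [N HN].
    { apply Rdiv_lt_0_compat; [apply cond_pos|lra]. }
    exists N. intros n m hN hM. assert (a := HN n hN). assert (b := HN m hM).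
    assert (a' := hn1 n). assert (b' := hn1 m).
    assert (p : eps / (2 * K + 1) * (2 * K + 1) = eps) by (field; lra).
    set (e := eps / (2 * K + 1)) in *.
    eapply Rle_lt_trans; [apply H|]; try lra; rewrite ?Rabs_pos_eq by lra; try lra.
    nra. }
  destruct hu as [l hu].
  assert (Hl : forall h, h <> 0 -> Rabs h <= d ->
    Rabs ((f (x + h) - f x) / h - l) <= K * Rabs h).
  { intros h hh hhd. apply le_epsilon. intros eps he.
    apply is_lim_seq_spec in hu.
    destruct (hu (mkposreal (eps / 2) ltac:(lra))) as [N HN].
    destruct (hs (eps / (2 * K + 1) / 2)) as [N' HN'].
    { apply Rdiv_lt_0_compat; [|lra]. apply Rdiv_lt_0_compat; lra. }
    set (n := max N N'). specialize (HN n (Nat.le_max_l _ _)).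
    specialize (HN' n (Nat.le_max_r _ _)). simpl in HN.
    assert (a := hn1 n).
    assert (b := H h (hn n) hh ltac:(lra) hhd ltac:(rewrite Rabs_pos_eq; lra)).
    rewrite (Rabs_pos_eq (hn n)) in b by lra. fold (u n) in b.
    assert (p : eps / (2 * K + 1) * (2 * K + 1) = eps) by (field; lra).
    set (e := eps / (2 * K + 1)) in *.
    replace ((f (x + h) - f x) / h - l) with (((f (x + h) - f x) / h - u n) + (u n - l)) by ring.
    eapply Rle_trans; [apply Rabs_triang|].
    assert (K * hn n <= eps / 2) by nra. lra. }
  exists l. split; [|exact Hl].
  apply is_derive_eps. intros eps he.
  exists (Rmin d (eps / (K + 1))). split.
  { apply Rmin_pos; [lra|apply Rdiv_lt_0_compat; lra]. }
  intros y hy.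
  assert (m1 := Rmin_l d (eps / (K + 1))). assert (m2 := Rmin_r d (eps / (K + 1))).
  destruct (Req_dec y x) as [e|ne].
  { subst y. rewrite !Rminus_diag, Rmult_0_r, Rminus_0_r, Rabs_R0. lra. }
  specialize (Hl (y - x) ltac:(lra) ltac:(lra)).
  replace (x + (y - x)) with y in Hl by ring.
  replace (f y - f x - l * (y - x)) with (((f y - f x) / (y - x) - l) * (y - x)) by (field; lra).
  rewrite Rabs_mult. apply Rmult_le_compat_r; [apply Rabs_pos|].
  eapply Rle_trans; [exact Hl|].
  assert (p : eps / (K + 1) * (K + 1) = eps) by (field; lra).
  set (e := eps / (K + 1)) in *. assert (Rabs (y - x) <= e) by lra.
  assert (q := Rabs_pos (y - x)). nra.
Qed.

(** Symmetry of mixed derivatives in the form where the existence of the time derivative of fx is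
    part of the conclusion. The second difference of f over a rectangle, by the mean value theorem
    first in t and then in x, equals ftx at an inner point times the area. *)
Lemma mixed_derivative (f fx ft ftx : R -> R -> R) (x t r : R) :
  0 < r ->
  (forall x' t', Rabs (x' - x) < r -> Rabs (t' - t) < r ->
     is_derive (fun a => f a t') x' (fx x' t') /\
     is_derive (fun b => f x' b) t' (ft x' t') /\
     is_derive (fun a => ft a t') x' (ftx x' t')) ->
  continuity_2d_pt ftx x t ->
  is_derive (fun b => fx x b) t (ftx x t).
Proof.
  intros hr H hc. apply is_derive_eps. intros eps he.
  destruct (hc (mkposreal eps he)) as [d Hd]. simpl in Hd.
  assert (m1 := Rmin_l d r). assert (m2 := Rmin_r d r).
  assert (m3 : 0 < Rmin d r) by (apply Rmin_pos; [apply cond_pos|lra]).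
  exists (Rmin d r). split; [exact m3|]. intros t' ht'.
  assert (hxx : Rabs (x - x) < r) by (rewrite Rminus_diag, Rabs_R0; lra).
  assert (htt : Rabs (t - t) < r) by (rewrite Rminus_diag, Rabs_R0; lra).
  (* The derivative at x of this auxiliary function is the error term to be bounded, and its
     difference quotients are second differences of f minus their expected value. *)
  apply (derive_le_of_dq
    (fun a => f a t' - f a t - ftx x t * (t' - t) * a) x _ _ (Rmin d r)).
  - assert (h1 := proj1 (H x t' hxx ltac:(lra))). assert (h2 := proj1 (H x t hxx htt)).
    auto_derive; [repeat split; eexists; eassumption|].
    rewrite (is_derive_unique (fun a : R => f a t') _ _ h1),
      (is_derive_unique (fun a : R => f a t) _ _ h2). ring.
  - exact m3.
  - intros h hh hlt.
    destruct (MVT_between (fun b => f (x + h) b - f x b) (fun b => ft (x + h) b - ft x b) t t')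
      as [b [hb eb]].
    { intros b hb. apply is_derive_diff; apply H; auto;
        try (replace (x + h - x) with h by ring; lra);
        unfold Rmin, Rmax, Rabs in *; repeat destruct Rle_dec; repeat destruct Rcase_abs; lra. }
    assert (hb' : Rabs (b - t) < Rmin d r).
    { eapply Rle_lt_trans; [|exact ht'].
      unfold Rmin, Rmax, Rabs in *; repeat destruct Rle_dec; repeat destruct Rcase_abs; lra. }
    destruct (MVT_between (fun a => ft a b) (fun a => ftx a b) x (x + h)) as [a [ha ea]].
    { intros a ha. apply H; try lra.
      assert (Rabs (a - x) <= Rabs h); [|lra].
      unfold Rmin, Rmax, Rabs in *; repeat destruct Rle_dec; repeat destruct Rcase_abs; lra. }
    rewrite ea in eb.
    replace ((f (x + h) t' - f (x + h) t - ftx x t * (t' - t) * (x + h) -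
      (f x t' - f x t - ftx x t * (t' - t) * x)) / h)
      with ((ftx a b - ftx x t) * (t' - t)).
    + rewrite Rabs_mult. apply Rmult_le_compat_r; [apply Rabs_pos|]. left.
      apply Hd; [|lra]. assert (Rabs (a - x) <= Rabs h); [|lra].
      unfold Rmin, Rmax, Rabs in *; repeat destruct Rle_dec; repeat destruct Rcase_abs; lra.
    + replace (f (x + h) t' - f (x + h) t - ftx x t * (t' - t) * (x + h) -
        (f x t' - f x t - ftx x t * (t' - t) * x))
        with ((f (x + h) t' - f x t') - (f (x + h) t - f x t) - ftx x t * (t' - t) * h) by ring.
      rewrite eb. field. auto.
Qed.

(** On a small box the quotients of f3 converge with rate K |h|, uniformly in the point. So f3 has
    an x-derivative, and this derivative is continuous as a uniform limit of continuous functions.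
    [mixed_derivative] for f1, whose time derivative is f3, then identifies it as the time
    derivative of f2. *)
Lemma caloric_regularity (D : R -> R -> Prop) f f1 f2 f3 :
  (forall x t, D x t -> locally_2d D x t) ->
  caloric D f f1 f2 f3 ->
  (forall x t, D x t -> continuity_2d_pt f2 x t) ->
  (forall x t, D x t -> continuity_2d_pt f3 x t) ->
  exists f4, forall x t, D x t ->
    is_derive (fun x' => f3 x' t) x (f4 x t) /\
    is_derive (fun t' => f2 x t') t (f4 x t) /\
    continuity_2d_pt f4 x t.
Proof.
  intros hD Hc hc2 hc3.
  exists (fun x t => Derive (fun x' => f3 x' t) x).
  assert (loc : forall x t, D x t -> exists d K, 0 < d /\ 0 <= K /\
     (forall x' t', box x t d x' t' -> D x' t') /\
     forall x' t', box x t d x' t' ->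
       is_derive (fun a => f3 a t') x' (Derive (fun a => f3 a t') x') /\
       forall h, h <> 0 -> Rabs h <= d ->
         Rabs (dq h f3 x' t' - Derive (fun a => f3 a t') x') <= K * Rabs h).
  { intros x t hx. destruct (hD x t hx) as [r0 Hr0].
    assert (hr0 := cond_pos r0). set (r := r0 / 2).
    assert (hbox : forall x' t', box x t r x' t' -> D x' t').
    { intros x' t' [h1 h2]. apply Hr0; unfold r in *; lra. }
    destruct (caloric_dq_cauchy x t r f f1 f2 f3) as (d & K & hd & hK & H).
    - unfold r; lra.
    - now apply (caloric_incl D).
    - auto.
    - exists (Rmin d r), K.
      assert (m1 := Rmin_l d r). assert (m2 := Rmin_r d r).
      split; [apply Rmin_pos; unfold r; lra|]. split; [exact hK|]. split.
      { intros x' t' [h1 h2]. apply hbox; split; lra. }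
      intros x' t' [h1 h2].
      destruct (cauchy_dq_derive (fun a => f3 a t') x' d K hd hK) as [l [hl Hl]].
      { intros h k hh hk hhd hkd. apply (H h k x' t'); auto. split; lra. }
      rewrite (is_derive_unique (fun a : R => f3 a t') _ _ hl).
      split; [exact hl|]. intros h hh hhd. apply Hl; auto; lra. }
  assert (hcont : forall x t, D x t ->
    continuity_2d_pt (fun x t => Derive (fun x' => f3 x' t) x) x t).
  { intros x t hx. destruct (loc x t hx) as (d & K & hd & hK & hbox & H).
    intros eps. assert (he := cond_pos eps).
    (* One fixed quotient serves the whole neighbourhood: it differs from the derivative by at most
       K h <= eps / 4 at both points, and by its own continuity it varies by less than eps / 4. *)
    set (h := Rmin d (eps / (4 * (K + 1)))).
    assert (m1 := Rmin_l d (eps / (4 * (K + 1)))). fold h in m1.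
    assert (m2 := Rmin_r d (eps / (4 * (K + 1)))). fold h in m2.
    assert (hh : 0 < h).
    { apply Rmin_pos; [lra|]. apply Rdiv_lt_0_compat; lra. }
    assert (p : eps / (4 * (K + 1)) * (4 * (K + 1)) = eps) by (field; lra).
    set (e := eps / (4 * (K + 1))) in *.
    assert (hKh : K * h <= eps / 4) by nra.
    assert (b0 : box x t d x t) by
      (split; rewrite Rminus_diag, Rabs_R0; lra).
    assert (bh : box x t d (x + h) t).
    { split; [|apply b0]. replace (x + h - x) with h by ring. rewrite Rabs_pos_eq; lra. }
    assert (hq : continuity_2d_pt (dq h f3) x t) by (apply continuity_2d_pt_dq; auto).
    destruct (hq (mkposreal (eps / 4) ltac:(lra))) as [d' Hd']. simpl in Hd'.
    exists (mkposreal (Rmin d d') ltac:(apply Rmin_pos; [lra|apply cond_pos])).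
    simpl. intros u v hu hv.
    assert (n1 := Rmin_l d d'). assert (n2 := Rmin_r d d').
    assert (k1 := Hd' u v ltac:(lra) ltac:(lra)).
    assert (k2 := proj2 (H u v ltac:(split; lra)) h ltac:(lra) ltac:(rewrite Rabs_pos_eq; lra)).
    assert (k3 := proj2 (H x t b0) h ltac:(lra) ltac:(rewrite Rabs_pos_eq; lra)).
    rewrite (Rabs_pos_eq h) in k2, k3 by lra.
    apply Rabs_def2 in k1. apply Rabs_le_between in k2, k3. apply Rabs_def1; lra. }
  intros x t hx. destruct (loc x t hx) as (d & K & hd & hK & hbox & H).
  assert (b0 : box x t d x t) by
    (split; rewrite Rminus_diag, Rabs_R0; lra).
  split; [now apply H|]. split; [|now apply hcont].
  apply (mixed_derivative f1 f2 f3 (fun x t => Derive (fun x' => f3 x' t) x) x t d); auto.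
  intros x' t' hx' ht'. assert (b : box x t d x' t') by (split; lra).
  split; [apply Hc; auto|]. split; [apply Hc; auto|]. now apply H.
Qed.

(** * Chain rules, one-sided derivatives and improper integrals *)

Lemma continuity_2d_pt_comp (f g h : R -> R -> R) (x y : R) :
  continuity_2d_pt f (g x y) (h x y) ->
  continuity_2d_pt g x y -> continuity_2d_pt h x y ->
  continuity_2d_pt (fun u v => f (g u v) (h u v)) x y.
Proof.
  intros Hf Hg Hh eps. destruct (Hf eps) as [d Hd].
  generalize (locally_2d_and _ _ _ _ (Hg d) (Hh d)).
  apply locally_2d_impl, locally_2d_forall. intros u v [h1 h2]. auto.
Qed.

Lemma continuity_2d_pt_snd (f : R -> R) (x y : R) :
  continuity_pt f y -> continuity_2d_pt (fun _ v => f v) x y.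
Proof.
  intros H. apply (continuity_1d_2d_pt_comp f (fun _ v => v)); [exact H|].
  apply continuity_2d_pt_id2.
Qed.

Lemma continuity_2d_pt_diag (f : R -> R -> R) (c : R -> R) (t : R) :
  continuity_2d_pt f (c t) t -> continuity_pt c t ->
  continuity_pt (fun b => f (c b) b) t.
Proof.
  intros Hf Hc. apply (continuity_2d_pt_fst_slice (fun b _ => f (c b) b) t 0).
  apply (continuity_2d_pt_comp f (fun b _ => c b) (fun b _ => b)); [exact Hf| |].
  - apply (continuity_1d_2d_pt_comp c (fun b _ => b)); [exact Hc|apply continuity_2d_pt_id1].
  - apply continuity_2d_pt_id1.
Qed.

Ltac cont2d := repeat first
  [ assumption | apply continuity_2d_pt_const | apply continuity_2d_pt_id1
  | apply continuity_2d_pt_id2 | apply continuity_2d_pt_minus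
  | apply continuity_2d_pt_plus | apply continuity_2d_pt_opp
  | apply continuity_2d_pt_mult | apply continuity_2d_pt_inv ].

(** Here g is a formula that continues f across the boundary of D, typically through [clamp]; its
    ordinary continuity implies continuity of f relative to D, whatever f is outside. *)
Lemma continuous2_on_intro (D : R -> R -> Prop) (f g : R -> R -> R) :
  (forall x t, D x t -> f x t = g x t /\ continuity_2d_pt g x t) ->
  continuous2_on D f.
Proof.
  intros H [x t] hD. simpl in hD. destruct (H x t hD) as [e hg].
  apply continuity_2d_pt_filterlim in hg. simpl. rewrite e.
  intros P HP. specialize (hg P HP). unfold filtermap, within in *.
  revert hg. apply filter_imp. intros [x' t'] hp hD'. simpl in *.
  destruct (H x' t' hD') as [e' _]. now rewrite e'.
Qed.

Lemma continuous2_on_locally (D : R -> R -> Prop) (f : R -> R -> R) (x t : R) :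
  continuous2_on D f -> D x t -> forall eps, 0 < eps -> exists d, 0 < d /\
  forall x' t', D x' t' -> Rabs (x' - x) < d -> Rabs (t' - t) < d ->
    Rabs (f x' t' - f x t) < eps.
Proof.
  intros H hD eps he. specialize (H (x, t) hD). simpl in H.
  destruct (H (fun y => Rabs (y - f x t) < eps)) as [d Hd].
  { exists (mkposreal eps he). intros y hy. exact hy. }
  exists d. split; [apply cond_pos|]. intros x' t' hD' h1 h2.
  apply (Hd (x', t')); [split; assumption|exact hD'].
Qed.

Lemma continuous2_on_interior (D : R -> R -> Prop) (f : R -> R -> R) (x t : R) :
  continuous2_on D f -> locally_2d D x t -> continuity_2d_pt f x t.
Proof.
  intros H hD eps.
  destruct (continuous2_on_locally D f x t H (locally_2d_singleton _ _ _ hD) eps (cond_pos eps))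
    as [d [hd Hd]].
  assert (l : locally_2d (fun u v => Rabs (u - x) < d /\ Rabs (v - t) < d) x t)
    by (exists (mkposreal d hd); auto).
  generalize (locally_2d_and _ _ _ _ hD l). apply locally_2d_impl, locally_2d_forall.
  intros u v [h1 [h2 h3]]. now apply Hd.
Qed.

Lemma continuous_on_continuity_pt (D : R -> Prop) (f : R -> R) (x : R) :
  continuous_on D f -> locally x D -> continuity_pt f x.
Proof.
  intros H hD. apply continuity_pt_filterlim. intros P HP.
  specialize (H x (locally_singleton _ _ hD) P HP). unfold filtermap, within in *.
  generalize (filter_and _ _ hD H). apply filter_imp. intros y [h1 h2]. auto.
Qed.

Lemma D_in_eps (f f' : R -> R) (D : R -> Prop) (x : R) :
  D_in f f' D x <->
  forall eps, 0 < eps -> exists d, 0 < d /\ forall y, D y -> Rabs (y - x) < d ->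
    Rabs (f y - f x - f' x * (y - x)) <= eps * Rabs (y - x).
Proof.
  split.
  - intros H eps he. destruct (H eps he) as [d [hd Hd]]. exists d; split; [exact hd|].
    intros y hy hyx. destruct (Req_dec y x) as [e|ne].
    { subst y. rewrite !Rminus_diag, Rmult_0_r, Rminus_0_r, Rabs_R0. lra. }
    specialize (Hd y (conj (conj hy (not_eq_sym ne)) hyx)). simpl in Hd. unfold R_dist in Hd.
    replace (f y - f x - f' x * (y - x)) with (((f y - f x) / (y - x) - f' x) * (y - x))
      by (field; lra).
    rewrite Rabs_mult. apply Rmult_le_compat_r; [apply Rabs_pos|lra].
  (* [D_in] asks for a strict inequality, hence the half. *)
  - intros H eps he. destruct (H (eps / 2) ltac:(lra)) as [d [hd Hd]].
    exists d; split; [exact hd|]. intros y [[hy ne] hyx]. simpl in *. unfold R_dist in *.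
    specialize (Hd y hy hyx).
    assert (p : 0 < Rabs (y - x)) by (apply Rabs_pos_lt; lra).
    apply (Rmult_lt_reg_r (Rabs (y - x))); [exact p|].
    rewrite <- Rabs_mult.
    replace (((f y - f x) / (y - x) - f' x) * (y - x)) with (f y - f x - f' x * (y - x))
      by (field; lra). nra.
Qed.

Lemma D_in_is_derive (f f' : R -> R) (D : R -> Prop) (x : R) :
  D_in f f' D x -> locally x D -> is_derive f x (f' x).
Proof.
  rewrite D_in_eps, is_derive_eps. intros H [r Hr] eps he.
  destruct (H eps he) as [d [hd Hd]].
  exists (Rmin d r). split; [apply Rmin_pos; [lra|apply cond_pos]|].
  assert (m1 := Rmin_l d r). assert (m2 := Rmin_r d r).
  intros y hy. apply Hd; [apply Hr|lra]. change (Rabs (y - x) < r). lra.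
Qed.

Lemma is_derive_D_in (f g f' : R -> R) (D : R -> Prop) (x : R) :
  is_derive g x (f' x) -> (forall y, D y -> f y = g y) -> D x -> D_in f f' D x.
Proof.
  rewrite D_in_eps, is_derive_eps. intros H e hx eps he.
  destruct (H eps he) as [d [hd Hd]]. exists d; split; [exact hd|].
  intros y hy hyx. rewrite !e by assumption. auto.
Qed.

(** Projection of the line onto [0, b], Lipschitz in x and b together. Composition with it turns
    continuity on the closed region 0 <= z <= s(t) into ordinary continuity in (z, t). *)
Definition clamp (b x : R) : R := Rmax 0 (Rmin x b).

Lemma clamp_bounds (b x : R) : 0 <= b -> 0 <= clamp b x <= b.
Proof. intros hb. unfold clamp, Rmax, Rmin; repeat destruct Rle_dec; lra. Qed.

Lemma clamp_id (b x : R) : 0 <= x <= b -> clamp b x = x.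
Proof. intros hb. unfold clamp, Rmax, Rmin; repeat destruct Rle_dec; lra. Qed.

Lemma clamp_lipschitz (b b' x x' : R) :
  Rabs (clamp b' x' - clamp b x) <= Rabs (x' - x) + Rabs (b' - b).
Proof.
  unfold clamp, Rmax, Rmin, Rabs; repeat destruct Rle_dec; repeat destruct Rcase_abs; lra.
Qed.

Lemma continuity_2d_pt_clamp (s : R -> R) (x t : R) :
  continuity_pt s t -> continuity_2d_pt (fun x t => clamp (s t) x) x t.
Proof.
  intros Hs eps. apply (continuity_2d_pt_snd s x) in Hs.
  destruct (Hs (mkposreal (eps / 2) ltac:(assert (h := cond_pos eps); lra))) as [d Hd].
  assert (he := cond_pos eps).
  exists (mkposreal (Rmin d (eps / 2)) ltac:(apply Rmin_pos; [apply cond_pos|lra])).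
  simpl. intros u v hu hv. assert (m1 := Rmin_l d (eps / 2)). assert (m2 := Rmin_r d (eps / 2)).
  specialize (Hd u v ltac:(lra) ltac:(lra)). simpl in Hd.
  eapply Rle_lt_trans; [apply clamp_lipschitz|]. lra.
Qed.

(* Turns one-sided derivatives at the ends of [0, b] into two-sided ones. *)
Definition ext (f f' : R -> R) (b x : R) : R :=
  f (clamp b x) + f' (clamp b x) * (x - clamp b x).

Lemma ext_id (f f' : R -> R) (b x : R) : 0 <= x <= b -> ext f f' b x = f x.
Proof. intros h. unfold ext. rewrite clamp_id by exact h. ring. Qed.

Lemma ext_is_derive (f f' : R -> R) (b x : R) : 0 < b ->
  (forall z, 0 <= z <= b -> D_in f f' (fun z => 0 <= z <= b) z) ->
  is_derive (ext f f' b) x (f' (clamp b x)).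
Proof.
  intros hb H. apply is_derive_eps. intros eps he.
  destruct (Rlt_le_dec x 0) as [h0|h0].
  { exists (- x). split; [lra|]. intros y hy. apply Rabs_def2 in hy.
    unfold ext. replace (clamp b x) with 0 by (unfold clamp, Rmax, Rmin; repeat destruct Rle_dec; lra).
    replace (clamp b y) with 0 by (unfold clamp, Rmax, Rmin; repeat destruct Rle_dec; lra).
    assert (hp := Rabs_pos (y - x)).
    match goal with |- Rabs ?e <= _ => replace e with 0 by ring end. rewrite Rabs_R0. nra. }
  destruct (Rlt_le_dec b x) as [h1|h1].
  { exists (x - b). split; [lra|]. intros y hy. apply Rabs_def2 in hy.
    unfold ext. replace (clamp b x) with b by (unfold clamp, Rmax, Rmin; repeat destruct Rle_dec; lra).
    replace (clamp b y) with b by (unfold clamp, Rmax, Rmin; repeat destruct Rle_dec; lra).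
    assert (hp := Rabs_pos (y - x)).
    match goal with |- Rabs ?e <= _ => replace e with 0 by ring end. rewrite Rabs_R0. nra. }
  specialize (H x (conj h0 h1)). rewrite D_in_eps in H. destruct (H eps he) as [d [hd Hd]].
  rewrite (clamp_id b x) by lra. rewrite (ext_id f f' b x) by lra.
  (* Outside [0, b] the continuation is exactly linear around an endpoint x;
     around an interior x, small neighbourhoods stay inside. *)
  pose (r0 := if Rlt_dec 0 x then x else d).
  pose (r1 := if Rlt_dec x b then b - x else d).
  assert (hr0 : 0 < r0) by (unfold r0; destruct (Rlt_dec 0 x); lra).
  assert (hr1 : 0 < r1) by (unfold r1; destruct (Rlt_dec x b); lra).
  exists (Rmin d (Rmin r0 r1)). split; [apply Rmin_pos; [exact hd|now apply Rmin_pos]|]. intros y hy.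
  assert (m1 := Rmin_l d (Rmin r0 r1)). assert (m2 := Rmin_r d (Rmin r0 r1)).
  assert (m3 := Rmin_l r0 r1). assert (m4 := Rmin_r r0 r1).
  assert (hp := Rabs_pos (y - x)).
  destruct (Rlt_le_dec y 0) as [k0|k0].
  { assert (e : x = 0).
    { unfold r0 in *. apply Rabs_def2 in hy. destruct (Rlt_dec 0 x); lra. }
    subst x. unfold ext.
    replace (clamp b y) with 0 by (unfold clamp, Rmax, Rmin; repeat destruct Rle_dec; lra).
    match goal with |- Rabs ?e <= _ => replace e with 0 by ring end. rewrite Rabs_R0. nra. }
  destruct (Rlt_le_dec b y) as [k1|k1].
  { assert (e : x = b).
    { unfold r1 in *. apply Rabs_def2 in hy. destruct (Rlt_dec x b); lra. }
    subst x. unfold ext.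
    replace (clamp b y) with b by (unfold clamp, Rmax, Rmin; repeat destruct Rle_dec; lra).
    match goal with |- Rabs ?e <= _ => replace e with 0 by ring end. rewrite Rabs_R0. nra. }
  rewrite ext_id by lra. apply Hd; lra.
Qed.

(** Continuity of one partial derivative is enough. The increment is split into a step in t at fixed
    x, where l is the derivative, and a step in x at fixed time, where the mean value theorem uses
    the continuous fx. *)
Lemma differentiable_of_partials (f fx : R -> R -> R) (x t l : R) :
  locally_2d (fun u v => is_derive (fun a => f a v) u (fx u v)) x t ->
  continuity_2d_pt fx x t -> is_derive (fun b => f x b) t l ->
  differentiable_pt_lim f x t (fx x t) l.
Proof.
  intros [r Hr] Hc Ht eps. assert (he := cond_pos eps).
  destruct (Hc (mkposreal (eps / 2) ltac:(lra))) as [d1 Hd1]. simpl in Hd1.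
  rewrite is_derive_eps in Ht. destruct (Ht (eps / 2) ltac:(lra)) as [d2 [hd2 Hd2]].
  assert (hm : 0 < Rmin r (Rmin d1 d2)) by (repeat apply Rmin_pos; try apply cond_pos; lra).
  exists (mkposreal _ hm). simpl. intros u v hu hv.
  assert (m1 := Rmin_l r (Rmin d1 d2)). assert (m2 := Rmin_r r (Rmin d1 d2)).
  assert (m3 := Rmin_l d1 d2). assert (m4 := Rmin_r d1 d2).
  assert (hb : forall c, Rmin x u <= c <= Rmax x u -> Rabs (c - x) <= Rabs (u - x)).
  { intros c hc. unfold Rmin, Rmax, Rabs in *; repeat destruct Rle_dec; repeat destruct Rcase_abs; lra. }
  destruct (MVT_between (fun a => f a v) (fun a => fx a v) x u) as [c [hc e]].
  { intros c hc. apply Hr; [specialize (hb c hc); lra|lra]. }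
  specialize (hb c hc). specialize (Hd1 c v ltac:(lra) ltac:(lra)).
  specialize (Hd2 v ltac:(lra)).
  replace (f u v - f x t - (fx x t * (u - x) + l * (v - t)))
    with ((fx c v - fx x t) * (u - x) + (f x v - f x t - l * (v - t))).
  2: { replace (f u v) with (f x v + fx c v * (u - x)) by lra. ring. }
  eapply Rle_trans; [apply Rabs_triang|]. rewrite Rabs_mult.
  assert (n1 := Rmax_l (Rabs (u - x)) (Rabs (v - t))).
  assert (n2 := Rmax_r (Rabs (u - x)) (Rabs (v - t))).
  assert (p1 := Rabs_pos (u - x)). assert (p2 := Rabs_pos (v - t)).
  assert (Rabs (fx c v - fx x t) * Rabs (u - x) <= eps / 2 * Rabs (u - x)) by nra.
  nra.
Qed.

(** Along the level set the linear part a dz + b dx is small compared with |dz| + |dx|. This first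
    gives |dz| <= C |dx|, after which it is small compared with |dx| alone. Differentiability of F
    at the single point suffices. *)
Lemma implicit_derive (F : R -> R -> R) (Z : R -> R) (x a b : R) :
  differentiable_pt_lim F (Z x) x a b -> a <> 0 -> continuity_pt Z x ->
  locally x (fun x' => F (Z x') x' = F (Z x) x) ->
  is_derive Z x (- b / a).
Proof.
  intros HF ha HZ [r0 Hr0]. apply is_derive_eps. intros eps he.
  assert (hA : 0 < Rabs a) by now apply Rabs_pos_lt.
  assert (hB := Rabs_pos b).
  (* From |a| |dz| <= e (|dz| + |dx|) + |b| |dx| with e <= |a| / 2. The second bound on e makes e (C
     + 1) <= eps |a| at the end. *)
  set (C := 2 * (Rabs b / Rabs a) + 1).
  assert (hC : 0 < C). { unfold C. assert (0 <= Rabs b / Rabs a) by (apply Rdiv_le_0_compat; lra). lra. }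
  set (e := Rmin (Rabs a / 2) (eps * Rabs a / (C + 1))).
  assert (hap : 0 < eps * Rabs a / (C + 1)).
  { apply Rdiv_lt_0_compat; [now apply Rmult_lt_0_compat|lra]. }
  assert (hep : 0 < e) by (apply Rmin_pos; lra).
  assert (e1 : e <= Rabs a / 2) by apply Rmin_l.
  assert (e2 : e <= eps * Rabs a / (C + 1)) by apply Rmin_r.
  destruct (HF (mkposreal e hep)) as [d Hd]. simpl in Hd.
  destruct (HZ d (cond_pos d)) as [r [hr Hr]]. simpl in Hr; unfold R_dist in Hr.
  exists (Rmin r0 (Rmin d r)). split; [repeat apply Rmin_pos; try apply cond_pos; lra|].
  assert (m1 := Rmin_l r0 (Rmin d r)). assert (m2 := Rmin_r r0 (Rmin d r)).
  assert (m3 := Rmin_l d r). assert (m4 := Rmin_r d r).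
  intros y hy.
  assert (hz : Rabs (Z y - Z x) < d).
  { destruct (Req_dec y x) as [eq|ne].
    - subst y. rewrite Rminus_diag, Rabs_R0. apply cond_pos.
    - apply Hr. repeat split; [auto|lra]. }
  assert (heq : F (Z y) y = F (Z x) x) by (apply Hr0; change (Rabs (y - x) < r0); lra).
  specialize (Hd (Z y) y hz ltac:(lra)). rewrite heq in Hd.
  assert (k1 : Rmax (Rabs (Z y - Z x)) (Rabs (y - x)) <= Rabs (Z y - Z x) + Rabs (y - x)).
  { assert (p1 := Rabs_pos (Z y - Z x)). assert (p2 := Rabs_pos (y - x)).
    apply Rmax_lub; lra. }
  set (dz := Z y - Z x) in *. set (dx := y - x) in *.
  replace (F (Z x) x - F (Z x) x - (a * dz + b * dx)) with (- (a * dz + b * dx)) in Hd by ring.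
  rewrite Rabs_Ropp in Hd.
  assert (p1 := Rabs_pos dz). assert (p2 := Rabs_pos dx).
  assert (k2 : Rabs a * Rabs dz <= Rabs (a * dz + b * dx) + Rabs b * Rabs dx).
  { rewrite <- !Rabs_mult. replace (a * dz) with ((a * dz + b * dx) + - (b * dx)) at 1 by ring.
    eapply Rle_trans; [apply Rabs_triang|]. rewrite Rabs_Ropp. lra. }
  assert (k3 : Rabs dz <= C * Rabs dx).
  { apply (Rmult_le_reg_l (Rabs a)); [exact hA|].
    replace (Rabs a * (C * Rabs dx)) with ((2 * Rabs b + Rabs a) * Rabs dx) by (unfold C; field; lra).
    nra. }
  replace (dz - - b / a * dx) with ((a * dz + b * dx) * / a) by (field; auto).
  rewrite Rabs_mult, Rabs_inv.
  apply (Rmult_le_reg_r (Rabs a)); [exact hA|]. rewrite Rmult_assoc, Rinv_l, Rmult_1_r by lra.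
  eapply Rle_trans; [exact Hd|].
  assert (k4 : e * (C + 1) <= eps * Rabs a).
  { replace (eps * Rabs a) with (eps * Rabs a / (C + 1) * (C + 1)) by (field; lra). nra. }
  assert (e * Rmax (Rabs dz) (Rabs dx) <= e * ((C + 1) * Rabs dx)).
  { apply Rmult_le_compat_l; lra. }
  nra.
Qed.

Lemma inverse_derive (f g : R -> R) (y a : R) :
  is_derive f (g y) a -> a <> 0 -> continuity_pt g y ->
  (forall y', f (g y') = y') -> is_derive g y (/ a).
Proof.
  intros Hf ha Hg e. replace (/ a) with (- (-1) / a) by (field; auto).
  apply (implicit_derive (fun z y => f z - y)); auto.
  - intros eps. rewrite is_derive_eps in Hf. destruct (Hf eps (cond_pos eps)) as [d [hd Hd]].
    exists (mkposreal d hd). simpl. intros u v hu hv. specialize (Hd u hu).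
    match goal with |- Rabs ?x <= _ =>
      replace x with (f u - f (g y) - a * (u - g y)) by ring end.
    eapply Rle_trans; [exact Hd|]. apply Rmult_le_compat_l; [left; apply cond_pos|apply Rmax_l].
  - apply filter_forall. intros y'. rewrite !e. ring.
Qed.

(* Curves c running inside [0, s] are approached by the interior curves
   (1 - k) c + k s / 2, along which the chain rule holds. *)
Lemma lateral_derive (f fx ft : R -> R -> R) (s ds c dc : R -> R) (t0 r : R) :
  0 < r ->
  (forall t, Rabs (t - t0) < r -> 0 < s t /\ 0 <= c t <= s t /\
     is_derive s t (ds t) /\ is_derive c t (dc t)) ->
  continuity_pt ds t0 -> continuity_pt dc t0 ->
  (forall x t, Rabs (t - t0) < r -> 0 < x < s t ->
     is_derive (fun x' => f x' t) x (fx x t) /\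
     is_derive (fun t' => f x t') t (ft x t) /\ continuity_2d_pt fx x t) ->
  (forall x t, Rabs (t - t0) < r ->
     continuity_2d_pt (fun x t => f (clamp (s t) x) t) x t) ->
  continuity_2d_pt (fun x t => fx (clamp (s t) x) t) (c t0) t0 ->
  continuity_2d_pt (fun x t => ft (clamp (s t) x) t) (c t0) t0 ->
  is_derive (fun t => f (c t) t) t0 (fx (c t0) t0 * dc t0 + ft (c t0) t0).
Proof.
  intros hr Hsc Hds Hdc Hf Hcf Hcfx Hcft.
  assert (ht0 : Rabs (t0 - t0) < r) by (rewrite Rminus_diag, Rabs_R0; lra).
  destruct (Hsc t0 ht0) as (hs0 & hc0 & Hs0 & Hc0).
  pose (cur := fun k t => (1 - k) * c t + k * (s t / 2)).
  pose (dcur := fun k t => (1 - k) * dc t + k * (ds t / 2)).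
  assert (cur0 : forall t, cur 0 t = c t) by (intros t; unfold cur; ring).
  assert (hcur : forall t, Rabs (t - t0) < r -> continuity_2d_pt cur 0 t).
  { intros t ht. destruct (Hsc t ht) as (_ & _ & Hs & Hc).
    assert (continuity_2d_pt (fun _ t => s t) 0 t).
    { apply continuity_2d_pt_snd. eapply is_derive_continuity_pt, Hs. }
    assert (continuity_2d_pt (fun _ t => c t) 0 t).
    { apply continuity_2d_pt_snd. eapply is_derive_continuity_pt, Hc. }
    unfold cur. unfold Rdiv. cont2d. }
  pose (G := fun k t => fx (clamp (s t) (cur k t)) t * dcur k t + ft (clamp (s t) (cur k t)) t).
  assert (G0 : G 0 t0 = fx (c t0) t0 * dc t0 + ft (c t0) t0).
  { unfold G. rewrite cur0, clamp_id by exact hc0. unfold dcur. f_equal. f_equal. ring. }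
  assert (HG : continuity_2d_pt G 0 t0).
  { unfold G. apply continuity_2d_pt_plus; [apply continuity_2d_pt_mult|].
    - apply (continuity_2d_pt_comp (fun x t => fx (clamp (s t) x) t) cur (fun _ t => t));
        [now rewrite cur0|now apply hcur|apply continuity_2d_pt_id2].
    - apply (continuity_2d_pt_snd ds 0) in Hds. apply (continuity_2d_pt_snd dc 0) in Hdc.
      unfold dcur, Rdiv. cont2d.
    - apply (continuity_2d_pt_comp (fun x t => ft (clamp (s t) x) t) cur (fun _ t => t));
        [now rewrite cur0|now apply hcur|apply continuity_2d_pt_id2]. }
  rewrite <- G0. apply is_derive_eps. intros eps he.
  destruct (HG (mkposreal eps he)) as [d Hd]. simpl in Hd.
  assert (hd := cond_pos d).
  assert (m1 := Rmin_l d r). assert (m2 := Rmin_r d r).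
  exists (Rmin d r). split; [apply Rmin_pos; lra|]. intros t ht.
  assert (hint : forall k t, 0 < k < 1 -> Rabs (t - t0) < r -> 0 < cur k t < s t).
  { intros k t' hk ht'. destruct (Hsc t' ht') as (h1 & h2 & _). unfold cur. nra. }
  (* G k is the derivative of f along the k-th interior curve. Continuity of G at (0, t0) jointly in
     k and t makes the mean value estimate uniform in k. *)
  assert (key : forall k, 0 < k < Rmin d 1 ->
    Rabs (f (cur k t) t - f (cur k t0) t0 - G 0 t0 * (t - t0)) <= eps * Rabs (t - t0)).
  { intros k hk. assert (n1 := Rmin_l d 1). assert (n2 := Rmin_r d 1).
    assert (hb : forall b, Rmin t0 t <= b <= Rmax t0 t -> Rabs (b - t0) <= Rabs (t - t0)).
    { intros b hb. unfold Rmin, Rmax, Rabs in *; repeat destruct Rle_dec; repeat destruct Rcase_abs; lra. }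
    destruct (MVT_between (fun b => f (cur k b) b) (G k) t0 t) as [b [hbb e]].
    - intros b hbb. specialize (hb b hbb). assert (hbr : Rabs (b - t0) < r) by lra.
      destruct (Hsc b hbr) as (_ & _ & Hs & Hc).
      assert (hi := hint k b ltac:(lra) hbr).
      destruct (Hf (cur k b) b hbr hi) as (d1 & d2 & d3).
      apply is_derive_Reals. unfold G. rewrite clamp_id by lra.
      replace (fx (cur k b) b * dcur k b + ft (cur k b) b)
        with (fx (cur k b) b * dcur k b + ft (cur k b) b * 1) by ring.
      apply (derivable_pt_lim_comp_2d f (cur k) (fun b => b)).
      + apply differentiable_of_partials; auto.
        assert (hsb : continuity_2d_pt (fun x t => s t - x) (cur k b) b).
        { apply continuity_2d_pt_minus; [|apply continuity_2d_pt_id1].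
          apply continuity_2d_pt_snd. eapply is_derive_continuity_pt, Hs. }
        destruct (hsb (mkposreal (s b - cur k b) ltac:(lra))) as [r1 Hr1]. simpl in Hr1.
        assert (hr2 : 0 < Rmin r1 (Rmin (cur k b) (r - Rabs (b - t0)))).
        { repeat apply Rmin_pos; try apply cond_pos; lra. }
        exists (mkposreal _ hr2). simpl. intros u v hu hv.
        assert (o1 := Rmin_l r1 (Rmin (cur k b) (r - Rabs (b - t0)))).
        assert (o2 := Rmin_r r1 (Rmin (cur k b) (r - Rabs (b - t0)))).
        assert (o3 := Rmin_l (cur k b) (r - Rabs (b - t0))).
        assert (o4 := Rmin_r (cur k b) (r - Rabs (b - t0))).
        specialize (Hr1 u v ltac:(lra) ltac:(lra)). apply Rabs_def2 in Hr1.
        apply Hf.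
        * replace (v - t0) with ((v - b) + (b - t0)) by ring.
          eapply Rle_lt_trans; [apply Rabs_triang|lra].
        * apply Rabs_def2 in hu. lra.
      + apply is_derive_Reals. unfold cur, dcur.
        auto_derive; [repeat split; eexists; eassumption|].
        rewrite (is_derive_unique (fun t : R => c t) _ _ Hc),
          (is_derive_unique (fun t : R => s t) _ _ Hs). field.
      + apply derivable_pt_lim_id.
    - specialize (hb b hbb). rewrite e.
      replace (G k b * (t - t0) - G 0 t0 * (t - t0)) with ((G k b - G 0 t0) * (t - t0)) by ring.
      rewrite Rabs_mult. apply Rmult_le_compat_r; [apply Rabs_pos|]. left. apply Hd; [|lra].
      rewrite Rminus_0_r, Rabs_pos_eq; lra. }
  (* Passage to k -> 0 in [key]: replacing the interior curve by c costs e' / 2 at each of the times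
     t and t0. *)
  apply le_epsilon. intros e' he'.
  assert (hF : forall b, Rabs (b - t0) < r -> exists d', 0 < d' /\ forall k, 0 < k < Rmin d' 1 ->
     Rabs (f (cur k b) b - f (c b) b) < e' / 2).
  { intros b hb. destruct (Hsc b hb) as (h1 & h2 & _).
    assert (hk : continuity_2d_pt (fun k b => f (clamp (s b) (cur k b)) b) 0 b).
    { apply (continuity_2d_pt_comp (fun x t => f (clamp (s t) x) t) cur (fun _ t => t));
        [rewrite cur0; now apply Hcf|now apply hcur|apply continuity_2d_pt_id2]. }
    destruct (hk (mkposreal (e' / 2) ltac:(lra))) as [d' Hd']. simpl in Hd'.
    exists d'. split; [apply cond_pos|]. intros k hkk.
    assert (n1 := Rmin_l d' 1). assert (n2 := Rmin_r d' 1).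
    specialize (Hd' k b ltac:(rewrite Rminus_0_r, Rabs_pos_eq; lra)
       ltac:(rewrite Rminus_diag, Rabs_R0; apply cond_pos)).
    rewrite cur0, !clamp_id in Hd'; auto. assert (h := hint k b ltac:(lra) hb). lra. }
  destruct (hF t ltac:(lra)) as [k1 [hk1 Hk1]]. destruct (hF t0 ht0) as [k2 [hk2 Hk2]].
  set (k := Rmin (Rmin k1 k2) (Rmin d 1) / 2).
  assert (o1 := Rmin_l (Rmin k1 k2) (Rmin d 1)). assert (o2 := Rmin_r (Rmin k1 k2) (Rmin d 1)).
  assert (o3 := Rmin_l k1 k2). assert (o4 := Rmin_r k1 k2). assert (o5 := Rmin_r d 1).
  assert (hkp : 0 < k) by (unfold k; assert (0 < Rmin (Rmin k1 k2) (Rmin d 1)); [repeat apply Rmin_pos; lra|lra]).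
  assert (hk : k <= Rmin (Rmin k1 k2) (Rmin d 1) / 2) by (unfold k; lra).
  specialize (key k ltac:(lra)).
  specialize (Hk1 k ltac:(split; [lra|apply Rmin_glb_lt; lra])).
  specialize (Hk2 k ltac:(split; [lra|apply Rmin_glb_lt; lra])).
  apply Rabs_def2 in Hk1, Hk2. apply Rabs_le_between in key.
  apply Rabs_le_between. lra.
Qed.

(** On [a, t] with a > 0 the ordinary fundamental theorem applies; the right limit l replaces a
    value of F at 0. *)
Lemma is_RInt_gen_at_right (F g : R -> R) (t l : R) :
  0 < t -> (forall x, 0 < x -> is_derive F x (g x)) ->
  (forall x, 0 < x -> continuity_pt g x) ->
  filterlim F (at_right 0) (locally l) ->
  is_RInt_gen g (at_right 0) (at_point t) (F t - l).
Proof.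
  intros ht HF Hg Hl P HP.
  assert (HP' : at_right 0 (fun a => P (F t - F a))).
  { apply (filterlim_comp _ _ _ F (fun y => F t - y) _ (locally l) (locally (F t - l)) Hl); [|exact HP].
    apply (continuous_minus (fun _ => F t) (fun y : R => y));
      [apply continuous_const|apply continuous_id]. }
  assert (hpos : at_right 0 (fun a => 0 < a)) by (exists (mkposreal 1 Rlt_0_1); auto).
  apply (Filter_prod _ _ _ (fun a => 0 < a /\ P (F t - F a)) (fun b => b = t)).
  - now apply filter_and.
  - reflexivity.
  - intros a b [ha hPa] hb. subst b. exists (F t - F a). split; [|exact hPa].
    simpl. apply (is_RInt_derive F g).
    + intros x hx. apply HF. unfold Rmin, Rmax in hx; repeat destruct Rle_dec; lra.
    + intros x hx. apply continuity_pt_filterlim, Hg.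
      unfold Rmin, Rmax in hx; repeat destruct Rle_dec; lra.
Qed.

Lemma RInt0_primitive (F g : R -> R) (t l : R) :
  0 < t -> (forall x, 0 < x -> is_derive F x (g x)) ->
  (forall x, 0 < x -> continuity_pt g x) ->
  filterlim F (at_right 0) (locally l) ->
  ex_RInt0 g t /\ RInt0 g t = F t - l.
Proof.
  intros ht HF Hg Hl. assert (H := is_RInt_gen_at_right F g t l ht HF Hg Hl).
  split; [now exists (F t - l)|]. now apply is_RInt_gen_unique.
Qed.

Lemma continuity_pt_cst (c x : R) : continuity_pt (fun _ => c) x.
Proof. now apply continuity_pt_const. Qed.

Lemma continuity_2d_pt_fst (f : R -> R) (x y : R) :
  continuity_pt f x -> continuity_2d_pt (fun u _ => f u) x y.
Proof.
  intros H. apply (continuity_1d_2d_pt_comp f (fun u _ => u)); [exact H|].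
  apply continuity_2d_pt_id1.
Qed.

Lemma continuity_2d_pt_snd_slice (f : R -> R -> R) (z t : R) :
  continuity_2d_pt f z t -> forall eps : posreal, exists d : posreal,
  forall v, Rabs (v - t) < d -> Rabs (f z v - f z t) < eps.
Proof.
  intros H eps. destruct (H eps) as [d Hd]. exists d. intros v hv. apply Hd; [|exact hv].
  rewrite Rminus_diag, Rabs_R0. apply cond_pos.
Qed.

Lemma is_derive_affine (f : R -> R) (a b x l : R) :
  is_derive f x l -> is_derive (fun t => a + b * f t) x (b * l).
Proof.
  intros H. auto_derive; [now exists l|].
  rewrite (is_derive_unique (fun x : R => f x) _ _ H). ring.
Qed.

Lemma at_right_scaled (f : R -> R) (a b l : R) :
  filterlim f (at_right 0) (locally l) ->
  filterlim (fun t => a + b * f t) (at_right 0) (locally (a + b * l)).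
Proof.
  intros H. apply (filterlim_comp _ _ _ f (fun y => a + b * y) _ (locally l)); [exact H|].
  apply (ex_derive_continuous (fun y : R => a + b * y)). auto_derive. exact I.
Qed.

Lemma RInt0_primitive_eq (F g g' : R -> R) (t l : R) :
  0 < t -> (forall x, 0 < x -> g x = g' x) ->
  (forall x, 0 < x -> is_derive F x (g' x)) ->
  (forall x, 0 < x -> continuity_pt g' x) ->
  filterlim F (at_right 0) (locally l) ->
  ex_RInt0 g t /\ RInt0 g t = F t - l.
Proof.
  intros ht e HF Hg. apply RInt0_primitive; auto.
  - intros x hx. rewrite e by exact hx. now apply HF.
  - intros x hx. apply (continuity_pt_ext_loc g'); [|now apply Hg].
    exists (mkposreal x hx). intros b hb. change (Rabs (b - x) < x) in hb.
    apply Rabs_def2 in hb. symmetry. apply e. lra.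
Qed.

Lemma continuity_pt_curve (s : R -> R) (f : R -> R -> R) (c : R -> R) (t : R) : 0 < t ->
  (forall b, 0 < b -> 0 <= c b <= s b) -> continuity_pt c t ->
  continuity_2d_pt (fun z t => f (clamp (s t) z) t) (c t) t ->
  continuity_pt (fun b => f (c b) b) t.
Proof.
  intros ht hc Hc Hf.
  apply (continuity_pt_ext_loc (fun b => f (clamp (s b) (c b)) b)).
  - exists (mkposreal t ht). intros b hb. change (Rabs (b - t) < t) in hb.
    apply Rabs_def2 in hb. now rewrite clamp_id by (apply hc; lra).
  - now apply (continuity_2d_pt_diag (fun z t => f (clamp (s t) z) t)).
Qed.

(** * From the Burgers equation to (P4) *)

(** All that the passage to (P4) uses about q = w_z / w. Continuity up to the lateral boundary is
    stated through [clamp] for q, q1, q2, while q3 is controlled only inside, as w_zzzz is. The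
    right side of [bu_xt] is the z-derivative of the Burgers equation. *)
Record burgers (s : R -> R) (q q1 q2 q3 : R -> R -> R) : Prop := {
  bu_s_pos : forall t, 0 < t -> 0 < s t;
  bu_s_cont : forall t, 0 < t -> continuity_pt s t;
  bu_x : space_deriv (cl_region zero_curve s) q q1;
  bu_xx : space_deriv (cl_region zero_curve s) q1 q2;
  bu_xxx : forall z t, region zero_curve s z t ->
    is_derive (fun z => q2 z t) z (q3 z t);
  bu_t : forall z t, region zero_curve s z t ->
    is_derive (fun t => q z t) t (q2 z t + 2 * q z t * q1 z t);
  bu_xt : forall z t, region zero_curve s z t ->
    is_derive (fun t => q1 z t) t (q3 z t + 2 * q1 z t ^ 2 + 2 * q z t * q2 z t);
  bu_cont : forall z t, 0 < t -> continuity_2d_pt (fun z t => q (clamp (s t) z) t) z t;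
  bu_x_cont : forall z t, 0 < t -> continuity_2d_pt (fun z t => q1 (clamp (s t) z) t) z t;
  bu_xx_cont : forall z t, 0 < t -> continuity_2d_pt (fun z t => q2 (clamp (s t) z) t) z t;
  bu_xxx_cont : forall z t, region zero_curve s z t -> continuity_2d_pt q3 z t;
  bu_le : forall z t, cl_region zero_curve s z t -> q z t <= 0;
  bu_x_lt : forall z t, cl_region zero_curve s z t -> q1 z t < 0
}.

Lemma cl_region_zero (s : R -> R) (z t : R) :
  0 < t -> 0 <= z <= s t -> cl_region zero_curve s z t.
Proof. now split. Qed.

Lemma region_zero (s : R -> R) (z t : R) :
  0 < t -> 0 < z < s t -> region zero_curve s z t.
Proof. now split. Qed.

Lemma region_cl_region (a b : R -> R) (x t : R) : region a b x t -> cl_region a b x t.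
Proof. intros [h1 h2]; split; lra. Qed.

Lemma region_locally (a b : R -> R) (x t : R) :
  continuity_pt a t -> continuity_pt b t -> region a b x t -> locally_2d (region a b) x t.
Proof.
  intros Ha Hb [ht hx].
  assert (h1 : continuity_2d_pt (fun x t => x - a t) x t).
  { apply continuity_2d_pt_minus; [apply continuity_2d_pt_id1|now apply continuity_2d_pt_snd]. }
  assert (h2 : continuity_2d_pt (fun x t => b t - x) x t).
  { apply continuity_2d_pt_minus; [now apply continuity_2d_pt_snd|apply continuity_2d_pt_id1]. }
  generalize (locally_2d_and _ _ _ _ (continuity_2d_pt_id2 x t (mkposreal t ht))
    (locally_2d_and _ _ _ _ (h1 (mkposreal (x - a t) ltac:(lra)))
      (h2 (mkposreal (b t - x) ltac:(lra))))).
  apply locally_2d_impl, locally_2d_forall. simpl. intros u v (k1 & k2 & k3).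
  apply Rabs_def2 in k1, k2, k3. split; lra.
Qed.

Lemma space_deriv_slice (s : R -> R) (f fx : R -> R -> R) (t : R) :
  space_deriv (cl_region zero_curve s) f fx -> 0 < t ->
  forall z, 0 <= z <= s t ->
    D_in (fun z => f z t) (fun z => fx z t) (fun z => 0 <= z <= s t) z.
Proof.
  intros H ht z hz. specialize (H z t (cl_region_zero s z t ht hz)).
  rewrite D_in_eps in *. intros eps he. destruct (H eps he) as [d [hd Hd]].
  exists d; split; [exact hd|]. intros y hy. apply Hd. now split.
Qed.

Lemma space_deriv_interior (s : R -> R) (f fx : R -> R -> R) (z t : R) :
  space_deriv (cl_region zero_curve s) f fx -> region zero_curve s z t ->
  is_derive (fun z => f z t) z (fx z t).
Proof.
  intros H hz. apply (D_in_is_derive _ _ _ _ (H z t (region_cl_region _ _ _ _ hz))).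
  destruct hz as [ht hz]. unfold zero_curve in hz.
  assert (hr : 0 < Rmin z (s t - z)) by (apply Rmin_pos; lra).
  exists (mkposreal _ hr). intros y hy. change (Rabs (y - z) < Rmin z (s t - z)) in hy.
  assert (m1 := Rmin_l z (s t - z)). assert (m2 := Rmin_r z (s t - z)).
  apply Rabs_def2 in hy. apply cl_region_zero; lra.
Qed.

(** Positivity of [uq] in the form in which [field] asks for it, with sigma cleared. *)
Lemma numerator_neq0 (sigma m x : R) :
  0 < sigma -> 0 < 1 - 2 * m / sigma * x -> sigma - 2 * m * x <> 0.
Proof.
  intros hs hu e.
  replace (1 - 2 * m / sigma * x) with ((sigma - 2 * m * x) / sigma) in hu by (field; lra).
  rewrite e in hu. unfold Rdiv in hu. lra.
Qed.

Section Parametrization.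

Variables (sigma m : R) (s : R -> R) (q q1 q2 q3 : R -> R -> R).
Hypothesis hsigma : 0 < sigma.
Hypothesis hm : 0 < m.
Hypothesis hB : burgers s q q1 q2 q3.

(* Quantities of (P4) in the parameter z, with q = w_z / w: uq is exp (m y),
   Yq is y, pq is y_z = 1 / theta and thq is theta. *)
Definition uq z t := 1 - 2 * m / sigma * q z t.
Definition Yq z t := / m * ln (uq z t).
Definition pq z t := - (2 / sigma) * (q1 z t * / uq z t).
Definition thq z t := - (sigma / 2) * (uq z t * / q1 z t).

Definition pq_x z t :=
  - (2 / sigma) * (q2 z t * / uq z t + 2 * m / sigma * q1 z t * q1 z t * / uq z t * / uq z t).
Definition pq_xx z t :=
  - (2 / sigma) * (q3 z t * / uq z t + 6 * m / sigma * q1 z t * q2 z t * / uq z t * / uq z t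
    + 2 * (2 * m / sigma) * (2 * m / sigma) * q1 z t * q1 z t * q1 z t * / uq z t * / uq z t * / uq z t).
Definition thq_x z t :=
  sigma / 2 * (2 * m / sigma + uq z t * q2 z t * / q1 z t * / q1 z t).
(** Time derivatives are eliminated here and in [thq_t]: q_t and q_zt are replaced by the right
    sides of [bu_t] and [bu_xt]. *)
Definition Yq_t z t := - (2 / sigma) * ((q2 z t + 2 * q z t * q1 z t) * / uq z t).
Definition thq_t z t :=
  sigma / 2 * (2 * m / sigma * (q2 z t + 2 * q z t * q1 z t) * / q1 z t
    + uq z t * (q3 z t + 2 * (q1 z t * q1 z t) + 2 * q z t * q2 z t) * / q1 z t * / q1 z t).

(* theta_t, (1/theta)_y and (1/theta)_yy expressed in the parameter z *)
Definition theta_t_z z t := thq_x z t * (- Yq_t z t * thq z t) + thq_t z t.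
Definition inv_y_z z t := pq_x z t * thq z t.
Definition inv_yy_z z t := (pq_xx z t * thq z t + pq_x z t * thq_x z t) * thq z t.

Lemma uq_pos z t : cl_region zero_curve s z t -> 0 < uq z t.
Proof.
  intros h. assert (h1 := bu_le _ _ _ _ _ hB z t h). unfold uq.
  assert (0 < 2 * m / sigma) by (apply Rdiv_lt_0_compat; lra). nra.
Qed.

Lemma exp_Yq z t : cl_region zero_curve s z t -> exp (m * Yq z t) = uq z t.
Proof.
  intros h. unfold Yq. replace (m * (/ m * ln (uq z t))) with (ln (uq z t)) by (field; lra).
  apply exp_ln, uq_pos, h.
Qed.

Lemma pq_pos z t : cl_region zero_curve s z t -> 0 < pq z t.
Proof.
  intros h. assert (h1 := bu_x_lt _ _ _ _ _ hB z t h). assert (h2 := uq_pos z t h).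
  assert (0 < / uq z t) by now apply Rinv_0_lt_compat.
  assert (0 < 2 / sigma) by (apply Rdiv_lt_0_compat; lra).
  unfold pq. assert (0 < - q1 z t * / uq z t) by (apply Rmult_lt_0_compat; lra). nra.
Qed.

Lemma thq_inv z t : cl_region zero_curve s z t -> thq z t = / pq z t.
Proof.
  intros h. assert (h1 := bu_x_lt _ _ _ _ _ hB z t h). assert (h2 := uq_pos z t h).
  unfold thq, pq. field. repeat split; lra.
Qed.

Lemma thq_pos z t : cl_region zero_curve s z t -> 0 < thq z t.
Proof. intros h. rewrite thq_inv by exact h. apply Rinv_0_lt_compat, pq_pos, h. Qed.

(** At fixed y the parameter moves with velocity - y_t / y_z = - [Yq_t] [thq], which produces the
    first summand of [theta_t_z]. With time derivatives already eliminated, the equation is a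
    rational identity in q, q1, q2, q3. *)
Lemma parametric_pde z t : cl_region zero_curve s z t ->
  theta_t_z z t = - inv_yy_z z t - m * inv_y_z z t + sigma * uq z t.
Proof.
  intros h. assert (h1 := bu_x_lt _ _ _ _ _ hB z t h). assert (h2 := uq_pos z t h).
  unfold theta_t_z, inv_yy_z, inv_y_z, thq, thq_x, thq_t, pq_x, pq_xx, Yq_t, uq in *.
  field. repeat split; try lra; now apply numerator_neq0.
Qed.

Lemma clamp_region z t : 0 < t -> cl_region zero_curve s (clamp (s t) z) t.
Proof.
  intros ht. apply cl_region_zero; [exact ht|]. apply clamp_bounds.
  left. now apply (bu_s_pos _ _ _ _ _ hB).
Qed.

(* Each slice formula in q, q1 is differentiated up to the ends of [0, s t]
   by replacing q and q1 with their continuations. *)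
Lemma slice_ext z t : 0 < t -> 0 <= z <= s t ->
  is_derive (ext (fun z => q z t) (fun z => q1 z t) (s t)) z (q1 z t) /\
  is_derive (ext (fun z => q1 z t) (fun z => q2 z t) (s t)) z (q2 z t).
Proof.
  intros ht hz. assert (hs := bu_s_pos _ _ _ _ _ hB t ht). split.
  - assert (H := ext_is_derive _ _ (s t) z hs
      (space_deriv_slice s q q1 t (bu_x _ _ _ _ _ hB) ht)).
    simpl in H. now rewrite clamp_id in H.
  - assert (H := ext_is_derive _ _ (s t) z hs
      (space_deriv_slice s q1 q2 t (bu_xx _ _ _ _ _ hB) ht)).
    simpl in H. now rewrite clamp_id in H.
Qed.

(** * The change of variable from z to y and its inverse *)

Lemma Yq_D_in z t : 0 < t -> 0 <= z <= s t ->
  D_in (fun z => Yq z t) (fun z => pq z t) (fun z => 0 <= z <= s t) z.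
Proof.
  intros ht hz. destruct (slice_ext z t ht hz) as [d1 _].
  pose (e := ext (fun z => q z t) (fun z => q1 z t) (s t)). fold e in d1.
  assert (e0 : forall x, 0 <= x <= s t -> e x = q x t).
  { intros x hx. now apply (ext_id (fun z => q z t)). }
  assert (hu := uq_pos z t (cl_region_zero s z t ht hz)). unfold uq in hu.
  apply (is_derive_D_in _ (fun x => / m * ln (1 - 2 * m / sigma * e x))); [| |exact hz].
  - auto_derive.
    + split; [now exists (q1 z t)|]. rewrite e0 by exact hz. split; [lra|exact I].
    + rewrite (is_derive_unique (fun x : R => e x) _ _ d1), e0 by exact hz.
      unfold pq, uq. field. repeat split; try lra; now apply numerator_neq0.
  - intros x hx. unfold Yq, uq. now rewrite e0.
Qed.

(** Continued by its end tangents, which have positive slope, y becomes an increasing bijection of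
    the line at each t > 0. The inverse is then defined for every y and differentiable from both
    sides at Y0(t) and Y1(t). *)
Definition Ye z t := ext (fun z => Yq z t) (fun z => pq z t) (s t) z.

Lemma Ye_id z t : 0 <= z <= s t -> Ye z t = Yq z t.
Proof. intros h. unfold Ye. now rewrite ext_id. Qed.

Lemma Ye_derive z t : 0 < t -> is_derive (fun z => Ye z t) z (pq (clamp (s t) z) t).
Proof.
  intros ht. apply (ext_is_derive (fun z => Yq z t) (fun z => pq z t)).
  - now apply (bu_s_pos _ _ _ _ _ hB).
  - intros x hx. now apply Yq_D_in.
Qed.

Lemma Ye_lt z z' t : 0 < t -> z < z' -> Ye z t < Ye z' t.
Proof.
  intros ht hz. destruct (MVT_cor2 (fun z => Ye z t) (fun z => pq (clamp (s t) z) t) z z' hz)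
    as [c [e hc]].
  { intros c hc. apply is_derive_Reals, Ye_derive, ht. }
  assert (h := pq_pos _ t (clamp_region c t ht)). nra.
Qed.

Lemma Ye_inj z z' t : 0 < t -> Ye z t = Ye z' t -> z = z'.
Proof.
  intros ht e. destruct (Rtotal_order z z') as [h|[h|h]]; [|exact h|];
    apply (Ye_lt _ _ t ht) in h; lra.
Qed.

Lemma Ye_onto y t : 0 < t -> exists z, Ye z t = y.
Proof.
  intros ht. assert (hs := bu_s_pos _ _ _ _ _ hB t ht).
  assert (h0 := pq_pos 0 t (cl_region_zero s 0 t ht ltac:(lra))).
  assert (h1 := pq_pos (s t) t (cl_region_zero s (s t) t ht ltac:(lra))).
  (* Points on the two affine branches: the values of [Ye] there are Y at the end point minus,
     respectively plus, its distance to y, so they enclose y. *)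
  set (a := - (Rabs (y - Yq 0 t) / pq 0 t)). set (b := s t + Rabs (y - Yq (s t) t) / pq (s t) t).
  assert (ha : a <= 0).
  { unfold a. assert (0 <= Rabs (y - Yq 0 t) / pq 0 t); [|lra].
    apply Rdiv_le_0_compat; [apply Rabs_pos|exact h0]. }
  assert (hb : s t <= b).
  { unfold b. assert (0 <= Rabs (y - Yq (s t) t) / pq (s t) t); [|lra].
    apply Rdiv_le_0_compat; [apply Rabs_pos|exact h1]. }
  assert (Ha : Ye a t <= y).
  { unfold Ye, ext. replace (clamp (s t) a) with 0
      by (unfold clamp, Rmax, Rmin; repeat destruct Rle_dec; lra).
    replace (pq 0 t * (a - 0)) with (- Rabs (y - Yq 0 t)) by (unfold a; field; lra).
    assert (h := Rabs_maj2 (y - Yq 0 t)). lra. }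
  assert (Hb : y <= Ye b t).
  { unfold Ye, ext. replace (clamp (s t) b) with (s t)
      by (unfold clamp, Rmax, Rmin; repeat destruct Rle_dec; lra).
    replace (pq (s t) t * (b - s t)) with (Rabs (y - Yq (s t) t)) by (unfold b; field; lra).
    assert (h := Rle_abs (y - Yq (s t) t)). lra. }
  destruct (IVT_gen (fun z => Ye z t) a b y) as [z [_ hz]].
  - intros z. eapply is_derive_continuity_pt, Ye_derive, ht.
  - rewrite Rmin_left, Rmax_right; lra.
  - now exists z.
Qed.

(** Chosen as a total function of both arguments; its value is meaningful for t > 0 only. *)
Definition Zq (y t : R) : R := epsilon (inhabits 0) (fun z => Ye z t = y).

Lemma Ye_Zq y t : 0 < t -> Ye (Zq y t) t = y.
Proof. intros ht. apply (epsilon_spec (inhabits 0) (fun z => Ye z t = y)), Ye_onto, ht. Qed.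

Lemma Zq_Ye z t : 0 < t -> Zq (Ye z t) t = z.
Proof. intros ht. apply (Ye_inj _ _ t ht), Ye_Zq, ht. Qed.

Lemma Zq_Yq z t : cl_region zero_curve s z t -> Zq (Yq z t) t = z.
Proof. intros [ht hz]. rewrite <- Ye_id by exact hz. now apply Zq_Ye. Qed.

Lemma Ye_lt_inv z z' t : 0 < t -> Ye z t < Ye z' t -> z < z'.
Proof.
  intros ht h. destruct (Rtotal_order z z') as [h'|[h'|h']]; [exact h'| |].
  - subst; lra.
  - apply (Ye_lt _ _ t ht) in h'. lra.
Qed.

Lemma Zq_range y t : 0 < t -> Yq 0 t <= y <= Yq (s t) t -> 0 <= Zq y t <= s t.
Proof.
  intros ht hy. assert (hs := bu_s_pos _ _ _ _ _ hB t ht).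
  rewrite <- (Ye_id 0), <- (Ye_id (s t)) in hy by lra.
  split; apply Rnot_lt_le; intros h; apply (Ye_lt _ _ t ht) in h; rewrite Ye_Zq in h; lra.
Qed.

Lemma Zq_range_strict y t : 0 < t -> Yq 0 t < y < Yq (s t) t -> 0 < Zq y t < s t.
Proof.
  intros ht hy. assert (hs := bu_s_pos _ _ _ _ _ hB t ht).
  rewrite <- (Ye_id 0), <- (Ye_id (s t)) in hy by lra.
  split; apply (Ye_lt_inv _ _ t ht); rewrite Ye_Zq; lra.
Qed.

Lemma Yq_Zq y t : 0 < t -> Yq 0 t <= y <= Yq (s t) t -> Yq (Zq y t) t = y.
Proof.
  intros ht hy. rewrite <- Ye_id by now apply Zq_range. now apply Ye_Zq.
Qed.

Lemma Yq_range z t : cl_region zero_curve s z t -> Yq 0 t <= Yq z t <= Yq (s t) t.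
Proof.
  intros [ht hz]. unfold zero_curve in hz. assert (hs := bu_s_pos _ _ _ _ _ hB t ht).
  rewrite <- !Ye_id by lra. split.
  - destruct (Req_dec z 0) as [e|ne]; [subst; lra|]. left; apply Ye_lt; [exact ht|lra].
  - destruct (Req_dec z (s t)) as [e|ne]; [subst; lra|]. left; apply Ye_lt; [exact ht|lra].
Qed.

Lemma uq_clamp_cont z t : 0 < t ->
  continuity_2d_pt (fun z t => uq (clamp (s t) z) t) z t.
Proof.
  intros ht. assert (h := bu_cont _ _ _ _ _ hB z t ht). unfold uq. cont2d.
Qed.

Lemma uq_inv_clamp_cont z t : 0 < t ->
  continuity_2d_pt (fun z t => / uq (clamp (s t) z) t) z t.
Proof.
  intros ht. apply continuity_2d_pt_inv; [now apply uq_clamp_cont|].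
  assert (h := uq_pos _ t (clamp_region z t ht)). lra.
Qed.

Lemma q1_inv_clamp_cont z t : 0 < t ->
  continuity_2d_pt (fun z t => / q1 (clamp (s t) z) t) z t.
Proof.
  intros ht. apply continuity_2d_pt_inv; [now apply (bu_x_cont _ _ _ _ _ hB)|].
  assert (h := bu_x_lt _ _ _ _ _ hB _ t (clamp_region z t ht)). lra.
Qed.

Lemma Ye_cont z t : 0 < t -> continuity_2d_pt Ye z t.
Proof.
  intros ht. assert (hu := uq_pos _ t (clamp_region z t ht)).
  assert (h1 : continuity_2d_pt (fun z t => ln (uq (clamp (s t) z) t)) z t).
  { apply continuity_1d_2d_pt_comp; [|now apply uq_clamp_cont].
    eapply is_derive_continuity_pt, is_derive_ln, hu. }
  assert (h2 := uq_inv_clamp_cont z t ht).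
  assert (h3 := bu_x_cont _ _ _ _ _ hB z t ht).
  assert (h4 : continuity_2d_pt (fun z t => clamp (s t) z) z t)
    by (apply continuity_2d_pt_clamp; now apply (bu_s_cont _ _ _ _ _ hB)).
  unfold Ye, ext, Yq, pq. cont2d.
Qed.

(** Monotonicity replaces compactness: [Zq u v] lies between z - eps and z + eps as soon as u lies
    between the values of [Ye] at these two points at time v. Only continuity of [Ye] in t at two
    fixed points is used. *)
Lemma Zq_cont y t : 0 < t -> continuity_2d_pt Zq y t.
Proof.
  intros ht eps. assert (he := cond_pos eps). set (z := Zq y t).
  assert (ez : Ye z t = y) by now apply Ye_Zq.
  assert (l1 := Ye_lt (z - eps) z t ht ltac:(lra)).
  assert (l2 := Ye_lt z (z + eps) t ht ltac:(lra)).
  set (e1 := (y - Ye (z - eps) t) / 2). set (e2 := (Ye (z + eps) t - y) / 2).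
  assert (he1 : 0 < e1) by (unfold e1; lra). assert (he2 : 0 < e2) by (unfold e2; lra).
  destruct (continuity_2d_pt_snd_slice Ye _ t (Ye_cont (z - eps) t ht) (mkposreal _ he1)) as [d1 H1].
  destruct (continuity_2d_pt_snd_slice Ye _ t (Ye_cont (z + eps) t ht) (mkposreal _ he2)) as [d2 H2].
  simpl in H1, H2.
  (* Half of each gap is left for the change of y and half for the change of time; the entry t keeps
     v positive. *)
  set (d := Rmin (Rmin d1 d2) (Rmin t (Rmin e1 e2))).
  assert (hd : 0 < d) by (unfold d; repeat apply Rmin_pos; try apply cond_pos; lra).
  assert (m1 := Rmin_l (Rmin d1 d2) (Rmin t (Rmin e1 e2))).
  assert (m2 := Rmin_r (Rmin d1 d2) (Rmin t (Rmin e1 e2))). fold d in m1, m2.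
  assert (m3 := Rmin_l d1 d2). assert (m4 := Rmin_r d1 d2).
  assert (m5 := Rmin_l t (Rmin e1 e2)). assert (m6 := Rmin_r t (Rmin e1 e2)).
  assert (m7 := Rmin_l e1 e2). assert (m8 := Rmin_r e1 e2).
  exists (mkposreal d hd). simpl. intros u v hu hv.
  specialize (H1 v ltac:(lra)). specialize (H2 v ltac:(lra)).
  apply Rabs_def2 in hu, hv, H1, H2.
  assert (hv0 : 0 < v) by lra.
  assert (k1 : z - eps < Zq u v).
  { apply (Ye_lt_inv _ _ v hv0). rewrite Ye_Zq by exact hv0. unfold e1 in *. lra. }
  assert (k2 : Zq u v < z + eps).
  { apply (Ye_lt_inv _ _ v hv0). rewrite Ye_Zq by exact hv0. unfold e2 in *. lra. }
  apply Rabs_def1; lra.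
Qed.

Lemma region_locally_s z t : region zero_curve s z t -> locally_2d (region zero_curve s) z t.
Proof.
  intros h. apply region_locally; auto; [apply continuity_pt_cst|].
  apply (bu_s_cont _ _ _ _ _ hB), h.
Qed.

Lemma Zq_interior y t : 0 < t -> 0 < Zq y t < s t ->
  locally_2d (fun y t => region zero_curve s (Zq y t) t) y t.
Proof.
  intros ht hz.
  destruct (region_locally_s (Zq y t) t (region_zero s _ t ht hz)) as [d Hd].
  generalize (locally_2d_and _ _ _ _ (Zq_cont y t ht d) (continuity_2d_pt_id2 y t d)).
  apply locally_2d_impl, locally_2d_forall. intros u v [h1 h2]. now apply Hd.
Qed.

Lemma Zq_derive_y y t : 0 < t -> Yq 0 t <= y <= Yq (s t) t ->
  is_derive (fun y => Zq y t) y (thq (Zq y t) t).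
Proof.
  intros ht hy. assert (hz := Zq_range y t ht hy).
  assert (hc := cl_region_zero s _ t ht hz). rewrite thq_inv by exact hc.
  apply (inverse_derive (fun z => Ye z t)).
  - rewrite <- (clamp_id (s t) (Zq y t)) at 2 by exact hz. now apply Ye_derive.
  - assert (h := pq_pos _ t hc). lra.
  - apply continuity_2d_pt_fst_slice, Zq_cont, ht.
  - intros y'. now apply Ye_Zq.
Qed.

Lemma slice_interior z t : region zero_curve s z t ->
  is_derive (fun z => q z t) z (q1 z t) /\ is_derive (fun z => q1 z t) z (q2 z t).
Proof.
  intros h. split; apply (space_deriv_interior s); auto; apply hB.
Qed.

Lemma continuity_2d_pt_clamp_interior (f : R -> R -> R) z t : region zero_curve s z t ->
  continuity_2d_pt (fun z t => f (clamp (s t) z) t) z t -> continuity_2d_pt f z t.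
Proof.
  intros h. apply continuity_2d_pt_ext_loc.
  generalize (region_locally_s z t h). apply locally_2d_impl, locally_2d_forall. intros u v [h1 h2].
  unfold zero_curve in h2. rewrite clamp_id; [reflexivity|lra].
Qed.

Lemma interior_cont z t : region zero_curve s z t ->
  continuity_2d_pt q z t /\ continuity_2d_pt q1 z t /\ continuity_2d_pt q2 z t /\
  continuity_2d_pt q3 z t /\ continuity_2d_pt uq z t /\
  continuity_2d_pt (fun z t => / uq z t) z t /\ continuity_2d_pt (fun z t => / q1 z t) z t.
Proof.
  intros h. assert (ht := proj1 h).
  assert (c0 := continuity_2d_pt_clamp_interior q z t h (bu_cont _ _ _ _ _ hB z t ht)).
  assert (c1 := continuity_2d_pt_clamp_interior q1 z t h (bu_x_cont _ _ _ _ _ hB z t ht)).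
  assert (c2 := continuity_2d_pt_clamp_interior q2 z t h (bu_xx_cont _ _ _ _ _ hB z t ht)).
  assert (cu : continuity_2d_pt uq z t) by (unfold uq; cont2d).
  assert (hc := region_cl_region _ _ _ _ h).
  repeat split; auto.
  - now apply (bu_xxx_cont _ _ _ _ _ hB).
  - apply continuity_2d_pt_inv; [exact cu|]. assert (h1 := uq_pos z t hc). lra.
  - apply continuity_2d_pt_inv; [exact c1|]. assert (h1 := bu_x_lt _ _ _ _ _ hB z t hc). lra.
Qed.

Lemma Yq_differentiable z t : region zero_curve s z t ->
  differentiable_pt_lim Yq z t (pq z t) (Yq_t z t).
Proof.
  intros h. destruct (interior_cont z t h) as (c0 & c1 & c2 & c3 & cu & ciu & ci1).
  apply differentiable_of_partials.
  - generalize (region_locally_s z t h). apply locally_2d_impl, locally_2d_forall.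
    intros a b hab. destruct (slice_interior a b hab) as [d1 _].
    assert (hu := uq_pos a b (region_cl_region _ _ _ _ hab)).
    unfold Yq, pq. unfold uq in *.
    auto_derive; [split; [now exists (q1 a b)|split; [exact hu|exact I]]|].
    rewrite (is_derive_unique (fun x : R => q x b) _ _ d1). field. repeat split; try lra; now apply numerator_neq0.
  - unfold pq. cont2d.
  - assert (d1 := bu_t _ _ _ _ _ hB z t h).
    assert (hu := uq_pos z t (region_cl_region _ _ _ _ h)).
    unfold Yq, Yq_t. unfold uq in *.
    auto_derive; [split; [eexists; exact d1|split; [exact hu|exact I]]|].
    rewrite (is_derive_unique (fun x : R => q z x) _ _ d1). field. repeat split; try lra; now apply numerator_neq0.
Qed.

Lemma thq_derive_x z t : region zero_curve s z t ->
  is_derive (fun z => thq z t) z (thq_x z t).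
Proof.
  intros h. destruct (slice_interior z t h) as [d1 d2].
  assert (h1 := bu_x_lt _ _ _ _ _ hB z t (region_cl_region _ _ _ _ h)).
  unfold thq, thq_x, uq.
  auto_derive; [repeat split; try (eexists; eassumption); lra|].
  rewrite (is_derive_unique (fun x : R => q x t) _ _ d1),
    (is_derive_unique (fun x : R => q1 x t) _ _ d2). field. lra.
Qed.

Lemma thq_differentiable z t : region zero_curve s z t ->
  differentiable_pt_lim thq z t (thq_x z t) (thq_t z t).
Proof.
  intros h. destruct (interior_cont z t h) as (c0 & c1 & c2 & c3 & cu & ciu & ci1).
  apply differentiable_of_partials.
  - generalize (region_locally_s z t h). apply locally_2d_impl, locally_2d_forall.
    intros a b hab. now apply thq_derive_x.
  - unfold thq_x. cont2d.
  - assert (d1 := bu_t _ _ _ _ _ hB z t h). assert (d2 := bu_xt _ _ _ _ _ hB z t h).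
    assert (h1 := bu_x_lt _ _ _ _ _ hB z t (region_cl_region _ _ _ _ h)).
    unfold thq, thq_t, uq.
    auto_derive; [repeat split; try (eexists; eassumption); lra|].
    rewrite (is_derive_unique (fun x : R => q z x) _ _ d1),
      (is_derive_unique (fun x : R => q1 z x) _ _ d2). field. lra.
Qed.

(** Restricted to the open range, unlike [Zq_derive_y]: [implicit_derive] needs y to be
    differentiable in (z, t) jointly, which is available only inside. *)
Lemma Zq_derive_t y t : 0 < t -> Yq 0 t < y < Yq (s t) t ->
  is_derive (fun t => Zq y t) t (- Yq_t (Zq y t) t * thq (Zq y t) t).
Proof.
  intros ht hy. assert (hz := Zq_range_strict y t ht hy).
  assert (hr := region_zero s _ t ht hz). assert (hc := region_cl_region _ _ _ _ hr).
  rewrite thq_inv by exact hc. apply (implicit_derive Yq (fun t => Zq y t)).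
  - now apply Yq_differentiable.
  - assert (h := pq_pos _ t hc). lra.
  - intros eps he. destruct (continuity_2d_pt_snd_slice Zq y t (Zq_cont y t ht) (mkposreal eps he)) as [d Hd].
    exists d. split; [apply cond_pos|]. intros v [_ hv]. now apply Hd.
  - generalize (locally_2d_1d_const_x _ _ _ (Zq_interior y t ht hz)). apply filter_imp.
    intros v [hv hzv]. unfold zero_curve in hzv.
    rewrite <- !Ye_id by lra. now rewrite !Ye_Zq.
Qed.

Lemma pq_derive_x z t : region zero_curve s z t -> is_derive (fun z => pq z t) z (pq_x z t).
Proof.
  intros h. destruct (slice_interior z t h) as [d1 d2].
  assert (hu := uq_pos z t (region_cl_region _ _ _ _ h)).
  unfold pq, pq_x. unfold uq in *.
  auto_derive; [repeat split; try (eexists; eassumption); lra|].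
  rewrite (is_derive_unique (fun x : R => q x t) _ _ d1),
    (is_derive_unique (fun x : R => q1 x t) _ _ d2).
  set (k := 2 * m / sigma) in *. field. lra.
Qed.

Lemma pq_x_derive_x z t : region zero_curve s z t ->
  is_derive (fun z => pq_x z t) z (pq_xx z t).
Proof.
  intros h. destruct (slice_interior z t h) as [d1 d2].
  assert (d3 := bu_xxx _ _ _ _ _ hB z t h).
  assert (hu := uq_pos z t (region_cl_region _ _ _ _ h)).
  unfold pq_x, pq_xx. unfold uq in *.
  auto_derive; [repeat split; try (eexists; eassumption); lra|].
  rewrite (is_derive_unique (fun x : R => q x t) _ _ d1),
    (is_derive_unique (fun x : R => q1 x t) _ _ d2),
    (is_derive_unique (fun x : R => q2 x t) _ _ d3).
  replace (6 * m / sigma) with (3 * (2 * m / sigma)) by (field; lra).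
  set (k := 2 * m / sigma) in *. field. lra.
Qed.

Lemma inv_y_z_derive_x z t : region zero_curve s z t ->
  is_derive (fun z => inv_y_z z t) z (pq_xx z t * thq z t + pq_x z t * thq_x z t).
Proof.
  intros h. assert (d1 := pq_x_derive_x z t h). assert (d2 := thq_derive_x z t h).
  unfold inv_y_z. auto_derive; [repeat split; eexists; eassumption|].
  rewrite (is_derive_unique (fun x : R => pq_x x t) _ _ d1),
    (is_derive_unique (fun x : R => thq x t) _ _ d2). ring.
Qed.

(** * Regularity and derivatives of theta in (y, t) *)

Variables (theta : R -> R -> R) (Y0 Y1 : R -> R).
Hypothesis hY0 : forall t, 0 < t -> Y0 t = Yq 0 t.
Hypothesis hY1 : forall t, 0 < t -> Y1 t = Yq (s t) t.
Hypothesis hth : forall z t, cl_region zero_curve s z t -> theta (Yq z t) t = thq z t.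

Lemma cl_region_Zq y t : cl_region Y0 Y1 y t ->
  cl_region zero_curve s (Zq y t) t /\ theta y t = thq (Zq y t) t.
Proof.
  intros [ht hy]. rewrite hY0, hY1 in hy by exact ht.
  assert (hc := cl_region_zero s _ t ht (Zq_range y t ht hy)). split; [exact hc|].
  rewrite <- (hth _ t hc). now rewrite Yq_Zq.
Qed.

Lemma region_Zq y t : region Y0 Y1 y t <-> region zero_curve s (Zq y t) t.
Proof.
  split.
  - intros [ht hy]. rewrite hY0, hY1 in hy by exact ht.
    apply region_zero; [exact ht|]. now apply Zq_range_strict.
  - intros [ht hz]. split; [exact ht|]. rewrite hY0, hY1 by exact ht.
    assert (hs := bu_s_pos _ _ _ _ _ hB t ht).
    rewrite <- (Ye_id 0), <- (Ye_id (s t)) by lra.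
    rewrite <- (Ye_Zq y t ht). split; apply Ye_lt; auto; apply hz.
Qed.

Lemma region_Y_locally y t : region Y0 Y1 y t -> locally_2d (region Y0 Y1) y t.
Proof.
  intros h. apply region_Zq in h. destruct h as [ht hz].
  generalize (Zq_interior y t ht hz). apply locally_2d_impl, locally_2d_forall.
  intros u v. apply region_Zq.
Qed.

Definition thq_y y t := thq_x (Zq y t) t * thq (Zq y t) t.

(** On the closed slice theta agrees with a formula in the continuations of q and q1 composed with
    the total function [Zq], and this formula is differentiable from both sides. *)
Lemma thq_y_D_in : space_deriv (cl_region Y0 Y1) theta thq_y.
Proof.
  intros y t h. destruct (cl_region_Zq y t h) as [[_ hz] e]. destruct h as [ht hy].
  unfold zero_curve in hz. destruct (slice_ext (Zq y t) t ht hz) as [d1 d2].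
  pose (e0 := ext (fun z => q z t) (fun z => q1 z t) (s t)). fold e0 in d1.
  pose (e1 := ext (fun z => q1 z t) (fun z => q2 z t) (s t)). fold e1 in d2.
  assert (E0 : forall x, 0 <= x <= s t -> e0 x = q x t)
    by (intros x hx; now apply (ext_id (fun z => q z t))).
  assert (E1 : forall x, 0 <= x <= s t -> e1 x = q1 x t)
    by (intros x hx; now apply (ext_id (fun z => q1 z t))).
  assert (h1 := bu_x_lt _ _ _ _ _ hB _ t (cl_region_zero s _ t ht hz)).
  apply (is_derive_D_in _ (fun y => - (sigma / 2) * ((1 - 2 * m / sigma * e0 (Zq y t)) * / e1 (Zq y t)))).
  - unfold thq_y.
    replace (thq_x (Zq y t) t * thq (Zq y t) t) with (thq (Zq y t) t * thq_x (Zq y t) t) by ring.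
    apply (is_derive_comp (fun x => - (sigma / 2) * ((1 - 2 * m / sigma * e0 x) * / e1 x))
             (fun y => Zq y t)).
    + auto_derive.
      * repeat split; try (eexists; eassumption). rewrite E1 by exact hz. lra.
      * rewrite (is_derive_unique (fun x : R => e0 x) _ _ d1),
          (is_derive_unique (fun x : R => e1 x) _ _ d2), E0, E1 by exact hz.
        unfold thq_x, uq. field. lra.
    + apply Zq_derive_y; [exact ht|]. now rewrite hY0, hY1 in hy.
  - intros y' h'. destruct (cl_region_Zq y' t h') as [[_ hz'] e']. unfold zero_curve in hz'.
    rewrite e', E0, E1 by exact hz'. reflexivity.
  - now split.
Qed.

Lemma comp_Zq_cont (f : R -> R -> R) y t : 0 < t ->
  continuity_2d_pt f (Zq y t) t -> continuity_2d_pt (fun y t => f (Zq y t) t) y t.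
Proof.
  intros ht hf. apply (continuity_2d_pt_comp f Zq (fun _ t => t)); [exact hf| |].
  - now apply Zq_cont.
  - apply continuity_2d_pt_id2.
Qed.

Lemma thq_clamp_cont z t : 0 < t ->
  continuity_2d_pt (fun z t => thq (clamp (s t) z) t) z t.
Proof.
  intros ht. assert (h1 := uq_clamp_cont z t ht). assert (h2 := q1_inv_clamp_cont z t ht).
  unfold thq. cont2d.
Qed.

Lemma thq_x_clamp_cont z t : 0 < t ->
  continuity_2d_pt (fun z t => thq_x (clamp (s t) z) t) z t.
Proof.
  intros ht. assert (h1 := uq_clamp_cont z t ht). assert (h2 := q1_inv_clamp_cont z t ht).
  assert (h3 := bu_xx_cont _ _ _ _ _ hB z t ht). unfold thq_x. cont2d.
Qed.

Lemma theta_cont : continuous2_on (cl_region Y0 Y1) theta.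
Proof.
  apply (continuous2_on_intro _ _ (fun y t => thq (clamp (s t) (Zq y t)) t)).
  intros y t h. destruct (cl_region_Zq y t h) as [[ht hz] e]. split.
  - now rewrite clamp_id.
  - apply (comp_Zq_cont (fun z t => thq (clamp (s t) z) t)); [exact ht|].
    now apply thq_clamp_cont.
Qed.

Lemma thq_y_cont : continuous2_on (cl_region Y0 Y1) thq_y.
Proof.
  apply (continuous2_on_intro _ _ (fun y t =>
    thq_x (clamp (s t) (Zq y t)) t * thq (clamp (s t) (Zq y t)) t)).
  intros y t h. destruct (cl_region_Zq y t h) as [[ht hz] e]. split.
  - now rewrite clamp_id.
  - apply continuity_2d_pt_mult.
    + apply (comp_Zq_cont (fun z t => thq_x (clamp (s t) z) t)); [exact ht|].
      now apply thq_x_clamp_cont.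
    + apply (comp_Zq_cont (fun z t => thq (clamp (s t) z) t)); [exact ht|].
      now apply thq_clamp_cont.
Qed.

Lemma theta_derive_t y t : region Y0 Y1 y t ->
  is_derive (fun t => theta y t) t (theta_t_z (Zq y t) t).
Proof.
  intros h. assert (hz := proj1 (region_Zq y t) h). destruct h as [ht hy].
  apply (is_derive_ext_loc (fun t => thq (Zq y t) t)).
  - generalize (locally_2d_1d_const_x _ _ _ (region_Y_locally y t (conj ht hy))).
    apply filter_imp. intros v hv. symmetry.
    now apply cl_region_Zq, region_cl_region.
  - unfold theta_t_z.
    replace (thq_x (Zq y t) t * (- Yq_t (Zq y t) t * thq (Zq y t) t) + thq_t (Zq y t) t)
      with (thq_x (Zq y t) t * (- Yq_t (Zq y t) t * thq (Zq y t) t) + thq_t (Zq y t) t * 1) by ring.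
    apply is_derive_Reals, (derivable_pt_lim_comp_2d thq (fun t => Zq y t) (fun t => t)).
    + now apply thq_differentiable.
    + apply is_derive_Reals, Zq_derive_t; [exact ht|]. now rewrite hY0, hY1 in hy.
    + apply derivable_pt_lim_id.
Qed.

Lemma inv_theta_derive_y y t : region Y0 Y1 y t ->
  is_derive (fun y => / theta y t) y (inv_y_z (Zq y t) t).
Proof.
  intros h. assert (hz := proj1 (region_Zq y t) h). destruct h as [ht hy].
  apply (is_derive_ext_loc (fun y => pq (Zq y t) t)).
  - generalize (locally_2d_1d_const_y _ _ _ (region_Y_locally y t (conj ht hy))).
    apply filter_imp. intros u hu.
    destruct (cl_region_Zq u t (region_cl_region _ _ _ _ hu)) as [hc e].
    now rewrite e, thq_inv, Rinv_inv.
  - unfold inv_y_z. rewrite Rmult_comm.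
    apply (is_derive_comp (fun z => pq z t) (fun y => Zq y t)).
    + now apply pq_derive_x.
    + apply Zq_derive_y; [exact ht|]. rewrite hY0, hY1 in hy by exact ht. lra.
Qed.

Lemma inv_theta_derive_yy y t : region Y0 Y1 y t ->
  is_derive (Derive_n (fun y => / theta y t) 1) y (inv_yy_z (Zq y t) t).
Proof.
  intros h. assert (hz := proj1 (region_Zq y t) h). destruct h as [ht hy].
  apply (is_derive_ext_loc (fun y => inv_y_z (Zq y t) t)).
  - generalize (locally_2d_1d_const_y _ _ _ (region_Y_locally y t (conj ht hy))).
    apply filter_imp. intros u hu. symmetry.
    apply (is_derive_unique (fun y => / theta y t)), inv_theta_derive_y, hu.
  - unfold inv_yy_z. rewrite Rmult_comm.
    apply (is_derive_comp (fun z => inv_y_z z t) (fun y => Zq y t)).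
    + now apply inv_y_z_derive_x.
    + apply Zq_derive_y; [exact ht|]. rewrite hY0, hY1 in hy by exact ht. lra.
Qed.

(** * Boundary conditions and integral identities *)

Variables (L v wm ds : R -> R).
Hypothesis hL : forall t, 0 < t -> 0 < L t.
Hypothesis hwm : forall t, 0 < t -> 0 < wm t.
Hypothesis hv : forall t, 0 < t -> 0 < v t.
Hypothesis hds : forall t, 0 < t -> is_derive s t (ds t).
(** The Stefan condition after division by w(s(t),t) = wm(t). The hypotheses on wm and v below are
    the derivatives of w along the two boundary curves, rewritten with w_t / w = w_zz / w = q1 +
    q^2. *)
Hypothesis hds_eq : forall t, 0 < t -> ds t = - (q (s t) t * (wm t / L t)).
Hypothesis hds_cont : forall t, 0 < t -> continuity_pt ds t.
Hypothesis hwm_derive : forall t, 0 < t ->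
  is_derive wm t (wm t * (q (s t) t * ds t + q1 (s t) t + q (s t) t ^ 2)).
Hypothesis hv_derive : forall t, 0 < t -> is_derive v t (v t * (q1 0 t + q 0 t ^ 2)).
Hypothesis hv0 : filterlim v (at_right 0) (locally (wm 0)).
Hypothesis hwm0 : 0 < wm 0.
Hypothesis hq0 : filterlim (fun t => q (s t) t) (at_right 0) (locally 0).

Lemma s_curve b : 0 < b -> 0 <= s b <= s b.
Proof. intros hb. assert (h := bu_s_pos _ _ _ _ _ hB b hb). lra. Qed.

Lemma zero_in_slice b : 0 < b -> 0 <= 0 <= s b.
Proof. intros hb. assert (h := bu_s_pos _ _ _ _ _ hB b hb). lra. Qed.

Lemma cl_right t : 0 < t -> cl_region zero_curve s (s t) t.
Proof. intros ht. apply cl_region_zero; [exact ht|now apply s_curve]. Qed.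

Lemma cl_left t : 0 < t -> cl_region zero_curve s 0 t.
Proof. intros ht. apply cl_region_zero; [exact ht|now apply zero_in_slice]. Qed.

Lemma qt_clamp_cont z t : 0 < t -> continuity_2d_pt
  (fun z t => q2 (clamp (s t) z) t + 2 * q (clamp (s t) z) t * q1 (clamp (s t) z) t) z t.
Proof.
  intros ht. assert (c0 := bu_cont _ _ _ _ _ hB z t ht).
  assert (c1 := bu_x_cont _ _ _ _ _ hB z t ht).
  assert (c2 := bu_xx_cont _ _ _ _ _ hB z t ht). cont2d.
Qed.

Lemma curve_derive (c dc : R -> R) t0 : 0 < t0 ->
  (forall t, 0 < t -> 0 <= c t <= s t) ->
  (forall t, 0 < t -> is_derive c t (dc t)) -> continuity_pt dc t0 ->
  is_derive (fun t => q (c t) t) t0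
    (q1 (c t0) t0 * dc t0 + (q2 (c t0) t0 + 2 * q (c t0) t0 * q1 (c t0) t0)).
Proof.
  intros ht0 hc hdc hdcc.
  apply (lateral_derive q q1 (fun z t => q2 z t + 2 * q z t * q1 z t) s ds c dc t0 t0); auto.
  - intros t ht. apply Rabs_def2 in ht. assert (hp : 0 < t) by lra.
    split; [now apply (bu_s_pos _ _ _ _ _ hB)|]. split; [now apply hc|].
    split; [now apply hds|now apply hdc].
  - intros x t ht hx. apply Rabs_def2 in ht.
    assert (hr := region_zero s x t ltac:(lra) hx). split; [now apply slice_interior|].
    split; [now apply (bu_t _ _ _ _ _ hB)|]. now apply interior_cont.
  - intros x t ht. apply Rabs_def2 in ht. apply (bu_cont _ _ _ _ _ hB); lra.
  - now apply (bu_x_cont _ _ _ _ _ hB).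
  - now apply qt_clamp_cont.
Qed.

(** A squeeze: y increases with z and decreases with q, so q(s(t),t) <= q(0,t) <= 0, and the left
    side tends to 0. *)
Lemma q_left_lim : filterlim (fun t => q 0 t) (at_right 0) (locally 0).
Proof.
  apply (filterlim_le_le (fun t => q (s t) t) (fun t => q 0 t) (fun _ => 0) 0).
  - exists (mkposreal 1 Rlt_0_1). intros t _ ht. split.
    + assert (h := Yq_range 0 t (cl_left t ht)).
      assert (u0 := uq_pos 0 t (cl_left t ht)). assert (u1 := uq_pos _ t (cl_right t ht)).
      assert (hs := bu_s_pos _ _ _ _ _ hB t ht).
      assert (hl := Ye_lt 0 (s t) t ht hs). rewrite !Ye_id in hl by lra.
      unfold Yq in hl. assert (hi : 0 < / m) by now apply Rinv_0_lt_compat.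
      apply Rmult_lt_reg_l in hl; [|exact hi].
      apply ln_lt_inv in hl; auto. unfold uq in hl.
      assert (hk : 0 < 2 * m / sigma) by (apply Rdiv_lt_0_compat; lra).
      nra.
    + apply (bu_le _ _ _ _ _ hB), cl_left, ht.
  - exact hq0.
  - apply filterlim_const.
Qed.

Lemma Yq_exp_curve (c : R -> R) t : 0 < t -> 0 <= c t <= s t ->
  exp (m * Yq (c t) t) = uq (c t) t /\ Zq (Yq (c t) t) t = c t /\
  theta (Yq (c t) t) t = thq (c t) t.
Proof.
  intros ht hc. assert (h := cl_region_zero s _ t ht hc).
  split; [now apply exp_Yq|]. split; [now apply Zq_Yq|now apply hth].
Qed.

(** With u - 1 = - (2 m / sigma) q and u / theta = - (2 / sigma) q_z, the first summand yields the
    q_z s' term through the Stefan condition and the 2 q q_z term. The factor (theta_y - m theta) /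
    theta^3 is (2 / sigma) q_zz / u. *)
Lemma I1_integrand_eq t : 0 < t ->
  I1_integrand sigma m L wm theta thq_y Y1 t =
  - (2 / sigma) * (q1 (s t) t * ds t + (q2 (s t) t + 2 * q (s t) t * q1 (s t) t)).
Proof.
  intros ht. unfold I1_integrand. rewrite hY1 by exact ht.
  destruct (Yq_exp_curve s t ht (s_curve t ht)) as (e1 & e2 & e3).
  unfold thq_y. rewrite e1, e2, e3, hds_eq by exact ht.
  assert (hu := uq_pos _ t (cl_right t ht)).
  assert (h1 := bu_x_lt _ _ _ _ _ hB _ t (cl_right t ht)).
  assert (hl := hL t ht). unfold thq_x, thq. unfold uq in *.
  field. repeat split; try lra; now apply numerator_neq0.
Qed.

Lemma I0_integrand_eq t : 0 < t ->
  I0_integrand sigma m theta thq_y Y0 t =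
  2 / sigma * (q2 0 t + 2 * q 0 t * q1 0 t).
Proof.
  intros ht. unfold I0_integrand. rewrite hY0 by exact ht.
  destruct (Yq_exp_curve (fun _ => 0) t ht (zero_in_slice t ht)) as (e1 & e2 & e3).
  unfold thq_y. rewrite e1, e2, e3.
  assert (hu := uq_pos _ t (cl_left t ht)).
  assert (h1 := bu_x_lt _ _ _ _ _ hB _ t (cl_left t ht)).
  unfold thq_x, thq. unfold uq in *.
  field. repeat split; try lra; now apply numerator_neq0.
Qed.

(** The squared term is q^2 and - sigma u / (2 theta) is q_z; their sum is w_zz / w at z = 0, that
    is v' / v. *)
Lemma Y0_integrand_eq t : 0 < t ->
  Y0_integrand sigma m theta Y0 t = q1 0 t + q 0 t ^ 2.
Proof.
  intros ht. unfold Y0_integrand. rewrite hY0 by exact ht.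
  destruct (Yq_exp_curve (fun _ => 0) t ht (zero_in_slice t ht)) as (e1 & e2 & e3).
  rewrite e1, e3.
  assert (hu := uq_pos _ t (cl_left t ht)).
  assert (h1 := bu_x_lt _ _ _ _ _ hB _ t (cl_left t ht)).
  unfold thq. unfold uq in *.
  field. repeat split; try lra; now apply numerator_neq0.
Qed.

Lemma I1_value t : 0 < t ->
  ex_RInt0 (I1_integrand sigma m L wm theta thq_y Y1) t /\
  1 + m * I1 sigma m L wm theta thq_y Y1 t = uq (s t) t.
Proof.
  intros ht.
  (* The primitive is u / m. Its limit at 0 is 1 / m because q tends to 0, which cancels the 1 in 1
     + m I1. *)
  destruct (RInt0_primitive_eq (fun t => / m + - (2 / sigma) * q (s t) t) _ _ t
              (/ m + - (2 / sigma) * 0) ht I1_integrand_eq) as [h1 h2].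
  - intros x hx. assert (d := curve_derive s ds x hx s_curve hds (hds_cont x hx)).
    now apply is_derive_affine.
  - intros x hx. assert (hs := bu_s_cont _ _ _ _ _ hB x hx).
    assert (c1 := continuity_pt_curve s q1 s x hx s_curve hs (bu_x_cont _ _ _ _ _ hB _ x hx)).
    assert (c2 := continuity_pt_curve s (fun z t => q2 z t + 2 * q z t * q1 z t)
       s x hx s_curve hs (qt_clamp_cont _ x hx)).
    assert (c3 := hds_cont x hx). simpl in c2.
    (* Functions of time are viewed as functions of two variables, constant in the second, so that
       [cont2d] applies. *)
    apply (continuity_2d_pt_fst _ x 0) in c1, c2, c3.
    apply (continuity_2d_pt_fst_slice (fun u _ => - (2 / sigma) * (q1 (s u) u * ds u
      + (q2 (s u) u + 2 * q (s u) u * q1 (s u) u))) x 0).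
    apply continuity_2d_pt_mult; [apply continuity_2d_pt_const|].
    apply continuity_2d_pt_plus; [cont2d|exact c2].
  - now apply at_right_scaled.
  - split; [exact h1|]. unfold I1. rewrite h2. unfold uq. field. lra.
Qed.

Lemma I0_value t : 0 < t ->
  ex_RInt0 (I0_integrand sigma m theta thq_y Y0) t /\
  1 + m * I0 sigma m theta thq_y Y0 t = uq 0 t.
Proof.
  intros ht.
  destruct (RInt0_primitive_eq (fun t => - / m + 2 / sigma * q 0 t) _ _ t
              (- / m + 2 / sigma * 0) ht I0_integrand_eq) as [h1 h2].
  - intros x hx. assert (d := curve_derive (fun _ => 0) (fun _ => 0) x hx zero_in_slice
      (fun t _ => is_derive_const 0 t) (continuity_pt_cst 0 x)).
    simpl in d. rewrite Rmult_0_r, Rplus_0_l in d. now apply is_derive_affine.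
  - intros x hx.
    assert (c2 := continuity_pt_curve s (fun z t => q2 z t + 2 * q z t * q1 z t)
       (fun _ => 0) x hx zero_in_slice (continuity_pt_cst 0 x)
       (qt_clamp_cont _ x hx)).
    simpl in c2. apply (continuity_2d_pt_fst _ x 0) in c2.
    apply (continuity_2d_pt_fst_slice (fun u _ => 2 / sigma *
      (q2 0 u + 2 * q 0 u * q1 0 u)) x 0).
    apply continuity_2d_pt_mult; [apply continuity_2d_pt_const|exact c2].
  - apply at_right_scaled, q_left_lim.
  - split; [exact h1|]. unfold I0. rewrite h2. unfold uq. field. lra.
Qed.

Lemma Y0_integral_value t : 0 < t ->
  ex_RInt0 (Y0_integrand sigma m theta Y0) t /\
  RInt0 (Y0_integrand sigma m theta Y0) t = ln (v t / wm 0).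
Proof.
  intros ht.
  destruct (RInt0_primitive_eq (fun t => ln (v t)) _ _ t (ln (wm 0)) ht Y0_integrand_eq)
    as [h1 h2].
  - intros x hx. assert (d := hv_derive x hx). assert (hvx := hv x hx).
    auto_derive; [split; [eexists; exact d|split; [exact hvx|exact I]]|].
    rewrite (is_derive_unique (fun x : R => v x) _ _ d). field. lra.
  - intros x hx.
    assert (hc := continuity_pt_cst 0 x).
    assert (c0 := continuity_pt_curve s q (fun _ => 0) x hx zero_in_slice hc (bu_cont _ _ _ _ _ hB _ x hx)).
    assert (c1 := continuity_pt_curve s q1 (fun _ => 0) x hx zero_in_slice hc (bu_x_cont _ _ _ _ _ hB _ x hx)).
    simpl in c0, c1. apply (continuity_2d_pt_fst _ x 0) in c0, c1.
    apply (continuity_2d_pt_fst_slice (fun u _ => q1 0 u + q 0 u ^ 2) x 0).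
    simpl. cont2d.
  - apply (filterlim_comp _ _ _ v ln _ (locally (wm 0))); [exact hv0|].
    apply (ex_derive_continuous ln). exists (/ wm 0). now apply is_derive_ln.
  - split; [exact h1|]. rewrite h2. unfold Rdiv. rewrite ln_mult, ln_Rinv; auto.
    now apply Rinv_0_lt_compat.
Qed.

(** The quadratic term is (2 / sigma) q^2 (1 - wm / L). It cancels the contributions of q s' and q^2
    in wm' / wm, leaving - (2 / sigma) q_z = u / theta. *)
Lemma Y1_bracket_eq t : 0 < t -> Y1_bracket sigma m L wm Y1 t = uq (s t) t / thq (s t) t.
Proof.
  intros ht. unfold Y1_bracket. rewrite hY1 by exact ht.
  destruct (Yq_exp_curve s t ht (s_curve t ht)) as (e1 & e2 & e3).
  rewrite e1, (is_derive_unique wm _ _ (hwm_derive t ht)), hds_eq by exact ht.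
  assert (hu := uq_pos _ t (cl_right t ht)).
  assert (h1 := bu_x_lt _ _ _ _ _ hB _ t (cl_right t ht)).
  assert (hl := hL t ht). assert (hw := hwm t ht). unfold thq. unfold uq in *.
  field. repeat split; try lra; now apply numerator_neq0.
Qed.

Lemma parametric_P4_solution : P4_solution sigma m L v wm theta thq_y Y0 Y1.
Proof.
  constructor.
  - intros t ht. rewrite hY0, hY1 by exact ht.
    assert (hs := bu_s_pos _ _ _ _ _ hB t ht).
    assert (h := Ye_lt 0 (s t) t ht hs). now rewrite !Ye_id in h by lra.
  - intros y t h. destruct (cl_region_Zq y t h) as [hc e]. rewrite e.
    assert (hp := thq_pos _ t hc). lra.
  - exact thq_y_D_in.
  - exact theta_cont.
  - exact thq_y_cont.
  - intros y t h. eexists. now apply theta_derive_t.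
  - apply (continuous2_on_intro _ _ (fun y t => theta_t_z (Zq y t) t)). intros y t h. split.
    + apply (is_derive_unique (fun t => theta y t)), theta_derive_t, h.
    + apply region_Zq in h. apply comp_Zq_cont; [apply h|].
      destruct (interior_cont _ t h) as (c0 & c1 & c2 & c3 & cu & ciu & ci1).
      unfold theta_t_z, thq_x, thq_t, Yq_t, thq. cont2d.
  - intros y t h. eexists. now apply inv_theta_derive_y.
  - intros y t h. eexists. now apply inv_theta_derive_yy.
  - apply (continuous2_on_intro _ _ (fun y t => inv_yy_z (Zq y t) t)). intros y t h. split.
    + apply (is_derive_unique (Derive_n (fun y => / theta y t) 1)), inv_theta_derive_yy, h.
    + apply region_Zq in h. apply comp_Zq_cont; [apply h|].
      destruct (interior_cont _ t h) as (c0 & c1 & c2 & c3 & cu & ciu & ci1).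
      unfold inv_yy_z, pq_xx, pq_x, thq_x, thq. cont2d.
  - intros y t h.
    rewrite (is_derive_unique (fun t : R => theta y t) _ _ (theta_derive_t y t h)).
    rewrite (is_derive_unique (fun y : R => / theta y t) _ _ (inv_theta_derive_y y t h)).
    change (Derive_n (fun y' => / theta y' t) 2 y)
      with (Derive (Derive_n (fun y => / theta y t) 1) y).
    rewrite (is_derive_unique _ _ _ (inv_theta_derive_yy y t h)).
    assert (hz := region_cl_region _ _ _ _ (proj1 (region_Zq y t) h)).
    (* Only the y inside the exponential is rewritten; the other three occurrences are arguments of
       [Zq]. *)
    rewrite <- (Yq_Zq y t (proj1 h)) at 4.
    + rewrite exp_Yq by exact hz. now apply parametric_pde.
    + destruct h as [ht hy]. rewrite hY0, hY1 in hy by exact ht. lra.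
  - intros t ht. now apply I1_value.
  - intros t ht. rewrite (proj2 (I1_value t ht)). apply uq_pos, cl_right, ht.
  - intros t ht. rewrite (proj2 (I1_value t ht)), hY1 by exact ht. unfold Yq. field. lra.
  - intros t ht. rewrite Y1_bracket_eq by exact ht.
    assert (h1 := uq_pos _ t (cl_right t ht)). assert (h2 := thq_pos _ t (cl_right t ht)).
    apply Rgt_not_eq, Rdiv_lt_0_compat; lra.
  - intros t ht. rewrite Y1_bracket_eq, hY1 by exact ht.
    destruct (Yq_exp_curve s t ht (s_curve t ht)) as (e1 & e2 & e3). rewrite e1, e3.
    assert (h1 := uq_pos _ t (cl_right t ht)). assert (h2 := thq_pos _ t (cl_right t ht)).
    field. lra.
  - intros t ht. now apply Y0_integral_value.
  - intros t ht. now apply Y0_integral_value.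
  - intros t ht. now apply I0_value.
  - intros t ht. rewrite (proj2 (I0_value t ht)). apply uq_pos, cl_left, ht.
  - intros t ht. rewrite (proj2 (I0_value t ht)), hY0 by exact ht. unfold Yq. field. lra.
Qed.

End Parametrization.

(** * From the heat equation to the Burgers equation *)

Lemma clamped_continuity (s : R -> R) (f : R -> R -> R) (z t : R) :
  (forall t, 0 < t -> 0 <= s t) -> continuity_pt s t ->
  continuous2_on (cl_region zero_curve s) f -> 0 < t ->
  continuity_2d_pt (fun z t => f (clamp (s t) z) t) z t.
Proof.
  intros hs Hs Hf ht eps.
  destruct (continuous2_on_locally _ f (clamp (s t) z) t Hf) with (eps := pos eps)
    as [d [hd Hd]].
  - apply cl_region_zero; [exact ht|]. now apply clamp_bounds, hs.
  - apply cond_pos.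
  - generalize (locally_2d_and _ _ _ _ (continuity_2d_pt_clamp s z t Hs (mkposreal d hd))
      (locally_2d_and _ _ _ _ (continuity_2d_pt_id2 z t (mkposreal d hd))
        (continuity_2d_pt_id2 z t (mkposreal t ht)))).
    apply locally_2d_impl, locally_2d_forall. simpl. intros u v (h1 & h2 & h3).
    apply Hd; auto. apply Rabs_def2 in h3. assert (hv : 0 < v) by lra.
    apply cl_region_zero; [exact hv|]. now apply clamp_bounds, hs.
Qed.

Section Heat.

Variables (L v wm : R -> R) (w wz wt wzz wzzz : R -> R -> R) (s : R -> R).
Hypothesis hdata : P1_data L v wm.
Hypothesis hP1 : P1_solution L v wm w wz wt wzz s.
Hypothesis hsign : forall z t, cl_region zero_curve s z t -> 0 < w z t /\ wz z t <= 0.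
Hypothesis hreg : lateral_regularity w wz wzz wzzz s.

Lemma s_continuity t : 0 < t -> continuity_pt s t.
Proof.
  intros ht. destruct (P1_s_diff _ _ _ _ _ _ _ _ hP1 t ht) as [l hl].
  eapply is_derive_continuity_pt, hl.
Qed.

Lemma region_locally_P1 z t : region zero_curve s z t -> locally_2d (region zero_curve s) z t.
Proof.
  intros h. apply region_locally; auto; [apply continuity_pt_cst|apply s_continuity, h].
Qed.

Lemma clamped_continuity_P1 f z t : continuous2_on (cl_region zero_curve s) f -> 0 < t ->
  continuity_2d_pt (fun z t => f (clamp (s t) z) t) z t.
Proof.
  intros hf ht. apply clamped_continuity; auto; [|now apply s_continuity].
  intros t' ht'. left. now apply (P1_s_pos _ _ _ _ _ _ _ _ hP1).
Qed.

Lemma cl_continuity_interior f z t : continuous2_on (cl_region zero_curve s) f ->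
  region zero_curve s z t -> continuity_2d_pt f z t.
Proof.
  intros hf h. apply (continuous2_on_interior (region zero_curve s));
    [|now apply region_locally_P1].
  intros [x y] hD P HP. specialize (hf (x, y) (region_cl_region _ _ _ _ hD) P HP).
  unfold filtermap, within in *. revert hf. apply filter_imp.
  intros p hp hp'. now apply hp, region_cl_region.
Qed.

(** A time derivative of w_z is not part of the hypotheses. It exists by [mixed_derivative], because
    w_t = w_zz has the continuous z-derivative w_zzz. *)
Lemma w_caloric : caloric (region zero_curve s) w wz wzz wzzz.
Proof.
  assert (ht : forall z t, region zero_curve s z t -> is_derive (fun t => w z t) t (wzz z t)).
  { intros z t h. rewrite (P1_heat _ _ _ _ _ _ _ _ hP1 z t h). now apply (P1_wt _ _ _ _ _ _ _ _ hP1). }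
  constructor; auto.
  - intros z t h. apply (space_deriv_interior s); [apply (P1_wz _ _ _ _ _ _ _ _ hP1)|exact h].
  - intros z t h. apply (space_deriv_interior s); [apply hreg|exact h].
  - intros z t h. apply (space_deriv_interior s); [apply hreg|exact h].
  - intros z t h. destruct (region_locally_P1 z t h) as [d Hd].
    apply (mixed_derivative w wz wzz wzzz z t d (cond_pos d)).
    + intros z' t' hz ht'. specialize (Hd z' t' hz ht'). split; [|split].
      * apply (space_deriv_interior s); [apply (P1_wz _ _ _ _ _ _ _ _ hP1)|exact Hd].
      * now apply ht.
      * apply (space_deriv_interior s); [apply hreg|exact Hd].
    + apply cl_continuity_interior; [apply hreg|exact h].
  - intros z t h. apply (continuous2_on_interior (region zero_curve s));
      [apply (P1_w_cont _ _ _ _ _ _ _ _ hP1)|now apply region_locally_P1].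
  - intros z t h. apply (continuous2_on_interior (region zero_curve s));
      [apply (P1_wz_cont _ _ _ _ _ _ _ _ hP1)|now apply region_locally_P1].
Qed.

(** * The logarithmic derivative, its sign and the Burgers equation *)

Definition lq z t := wz z t * / w z t.
Definition lq_z z t := wzz z t * / w z t - lq z t * lq z t.
Definition lq_zz z t := wzzz z t * / w z t - lq z t * wzz z t * / w z t - 2 * lq z t * lq_z z t.

Lemma cl_slice_ext z t : cl_region zero_curve s z t ->
  (is_derive (ext (fun z => w z t) (fun z => wz z t) (s t)) z (wz z t) /\
   is_derive (ext (fun z => wz z t) (fun z => wzz z t) (s t)) z (wzz z t) /\
   is_derive (ext (fun z => wzz z t) (fun z => wzzz z t) (s t)) z (wzzz z t)) /\
  0 <= z <= s t.
Proof.
  intros [ht hz]. unfold zero_curve in hz.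
  assert (hs := P1_s_pos _ _ _ _ _ _ _ _ hP1 t ht).
  assert (G : forall f fx : R -> R -> R, space_deriv (cl_region zero_curve s) f fx ->
    is_derive (ext (fun z => f z t) (fun z => fx z t) (s t)) z (fx z t)).
  { intros f fx h. assert (H := ext_is_derive _ _ (s t) z hs (space_deriv_slice s f fx t h ht)).
    simpl in H. now rewrite clamp_id in H. }
  split; [|exact hz].
  split; [apply G, (P1_wz _ _ _ _ _ _ _ _ hP1)|]. split; apply G, hreg.
Qed.

Lemma lq_space_deriv : space_deriv (cl_region zero_curve s) lq lq_z.
Proof.
  intros z t h. destruct (cl_slice_ext z t h) as [(d0 & d1 & _) hz].
  destruct (hsign z t h) as [hw _].
  pose (e0 := ext (fun z => w z t) (fun z => wz z t) (s t)). fold e0 in d0.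
  pose (e1 := ext (fun z => wz z t) (fun z => wzz z t) (s t)). fold e1 in d1.
  assert (E0 : forall x, 0 <= x <= s t -> e0 x = w x t)
    by (intros x hx; now apply (ext_id (fun z => w z t))).
  assert (E1 : forall x, 0 <= x <= s t -> e1 x = wz x t)
    by (intros x hx; now apply (ext_id (fun z => wz z t))).
  apply (is_derive_D_in _ (fun x => e1 x * / e0 x)); [| |exact h].
  - auto_derive.
    + rewrite E0 by exact hz. repeat split; try (eexists; eassumption). lra.
    + rewrite (is_derive_unique (fun x : R => e0 x) _ _ d0),
        (is_derive_unique (fun x : R => e1 x) _ _ d1), E0, E1 by exact hz.
      unfold lq_z, lq. field. lra.
  - intros x [_ hx]. unfold lq. now rewrite E0, E1.
Qed.

Lemma lq_z_space_deriv : space_deriv (cl_region zero_curve s) lq_z lq_zz.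
Proof.
  intros z t h. destruct (cl_slice_ext z t h) as [(d0 & d1 & d2) hz].
  destruct (hsign z t h) as [hw _].
  pose (e0 := ext (fun z => w z t) (fun z => wz z t) (s t)). fold e0 in d0.
  pose (e1 := ext (fun z => wz z t) (fun z => wzz z t) (s t)). fold e1 in d1.
  pose (e2 := ext (fun z => wzz z t) (fun z => wzzz z t) (s t)). fold e2 in d2.
  assert (E0 : forall x, 0 <= x <= s t -> e0 x = w x t)
    by (intros x hx; now apply (ext_id (fun z => w z t))).
  assert (E1 : forall x, 0 <= x <= s t -> e1 x = wz x t)
    by (intros x hx; now apply (ext_id (fun z => wz z t))).
  assert (E2 : forall x, 0 <= x <= s t -> e2 x = wzz x t)
    by (intros x hx; now apply (ext_id (fun z => wzz z t))).
  apply (is_derive_D_in _ (fun x => e2 x * / e0 x - e1 x * / e0 x * (e1 x * / e0 x)));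
    [| |exact h].
  - auto_derive.
    + rewrite E0 by exact hz. repeat split; try (eexists; eassumption); lra.
    + rewrite (is_derive_unique (fun x : R => e0 x) _ _ d0),
        (is_derive_unique (fun x : R => e1 x) _ _ d1),
        (is_derive_unique (fun x : R => e2 x) _ _ d2), E0, E1, E2 by exact hz.
      unfold lq_zz, lq_z, lq. field. lra.
  - intros x [_ hx]. unfold lq_z, lq. now rewrite E0, E1, E2.
Qed.

Lemma clamped_w z t : 0 < t -> 0 < w (clamp (s t) z) t.
Proof.
  intros ht. apply hsign, cl_region_zero; [exact ht|]. apply clamp_bounds.
  left. now apply (P1_s_pos _ _ _ _ _ _ _ _ hP1).
Qed.

Lemma w_inv_clamped_continuity z t : 0 < t ->
  continuity_2d_pt (fun z t => / w (clamp (s t) z) t) z t.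
Proof.
  intros ht. apply continuity_2d_pt_inv.
  - apply clamped_continuity_P1; [apply hreg|exact ht].
  - assert (h := clamped_w z t ht). lra.
Qed.

Lemma lq_clamped_continuity z t : 0 < t ->
  continuity_2d_pt (fun z t => lq (clamp (s t) z) t) z t.
Proof.
  intros ht. assert (c0 := w_inv_clamped_continuity z t ht).
  assert (c1 := clamped_continuity_P1 wz z t (lat_wz_cont _ _ _ _ _ hreg) ht).
  unfold lq. cont2d.
Qed.

Lemma lq_z_clamped_continuity z t : 0 < t ->
  continuity_2d_pt (fun z t => lq_z (clamp (s t) z) t) z t.
Proof.
  intros ht. assert (c0 := w_inv_clamped_continuity z t ht).
  assert (c1 := clamped_continuity_P1 wzz z t (lat_wzz_cont _ _ _ _ _ hreg) ht).
  assert (c2 := lq_clamped_continuity z t ht). unfold lq_z. cont2d.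
Qed.

Lemma lq_zz_clamped_continuity z t : 0 < t ->
  continuity_2d_pt (fun z t => lq_zz (clamp (s t) z) t) z t.
Proof.
  intros ht. assert (c0 := w_inv_clamped_continuity z t ht).
  assert (c1 := clamped_continuity_P1 wzz z t (lat_wzz_cont _ _ _ _ _ hreg) ht).
  assert (c2 := clamped_continuity_P1 wzzz z t (lat_wzzz_cont _ _ _ _ _ hreg) ht).
  assert (c3 := lq_clamped_continuity z t ht). assert (c4 := lq_z_clamped_continuity z t ht).
  unfold lq_zz. cont2d.
Qed.

Lemma lq_z_neg (sigma m : R) : 0 < sigma -> 0 < m ->
  (forall z t, cl_region zero_curve s z t -> det w wz wzz z t <> 0) ->
  (forall t, 0 < t -> y_par sigma m w wz 0 t < y_par sigma m w wz (s t) t) ->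
  forall z t, cl_region zero_curve s z t -> lq_z z t < 0.
Proof.
  intros hsigma hm hdet horder z t [ht hz]. unfold zero_curve in hz.
  assert (hs := P1_s_pos _ _ _ _ _ _ _ _ hP1 t ht).
  assert (hne : forall x, 0 <= x <= s t -> lq_z x t <> 0).
  { intros x hx e. apply (hdet x t (cl_region_zero s x t ht hx)).
    destruct (hsign x t (cl_region_zero s x t ht hx)) as [hw _].
    unfold det. replace (wzz x t * w x t - wz x t ^ 2) with (lq_z x t * w x t ^ 2)
      by (unfold lq_z, lq; field; lra). rewrite e. ring. }
  assert (hc : continuity (fun x => lq_z (clamp (s t) x) t)).
  { intros x. apply (continuity_2d_pt_fst_slice (fun x t => lq_z (clamp (s t) x) t)).
    now apply lq_z_clamped_continuity. }
  apply Rnot_le_lt. intros hge.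
  (* [lq_z] has no zero on the slice, as [det] is [lq_z] times w^2; a nonpositive value at x and the
     value at z would force one between them. *)
  assert (hpos : forall x, 0 <= x <= s t -> 0 < lq_z x t).
  { intros x hx. apply Rnot_le_lt. intros hle.
    destruct (IVT_gen _ x z 0 hc) as [y [hy e]].
    - rewrite !clamp_id by assumption. rewrite Rmin_left, Rmax_right by lra. lra.
    - assert (hy' : 0 <= y <= s t).
      { unfold Rmin, Rmax in hy; repeat destruct Rle_dec; lra. }
      rewrite clamp_id in e by exact hy'. now apply (hne y). }
  destruct (MVT_between (ext (fun x => lq x t) (fun x => lq_z x t) (s t))
     (fun x => lq_z (clamp (s t) x) t) 0 (s t)) as [c [hcc e]].
  { intros x _. apply (ext_is_derive (fun x => lq x t) (fun x => lq_z x t)); [exact hs|].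
    apply (space_deriv_slice s lq lq_z t lq_space_deriv ht). }
  rewrite !ext_id in e by lra. rewrite Rmin_left, Rmax_right in hcc by lra.
  rewrite clamp_id in e by exact hcc. specialize (hpos c hcc).
  (* As y is a decreasing function of [lq], this contradicts Y0 < Y1. *)
  assert (hl : lq 0 t < lq (s t) t) by nra.
  specialize (horder t ht). unfold y_par in horder.
  apply Rmult_lt_reg_l in horder; [|now apply Rinv_0_lt_compat].
  destruct (hsign 0 t (cl_region_zero s 0 t ht ltac:(lra))) as [w0 q0].
  destruct (hsign (s t) t (cl_region_zero s (s t) t ht ltac:(lra))) as [w1 q1].
  assert (E : forall x, 0 < w x t -> 1 - 2 * m * wz x t / (sigma * w x t) = 1 - 2 * m / sigma * lq x t)
    by (intros x hw; unfold lq; field; lra).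
  rewrite !E in horder by assumption.
  assert (hk : 0 < 2 * m / sigma) by (apply Rdiv_lt_0_compat; lra).
  assert (l1 : lq (s t) t <= 0).
  { unfold lq. assert (0 < / w (s t) t) by now apply Rinv_0_lt_compat. nra. }
  apply ln_lt_inv in horder; nra.
Qed.

Lemma lq_burgers : (forall z t, cl_region zero_curve s z t -> lq_z z t < 0) ->
  exists lq_zzz, burgers s lq lq_z lq_zz lq_zzz.
Proof.
  intros hneg.
  destruct (caloric_regularity (region zero_curve s) w wz wzz wzzz) as [w4 Hw4].
  - exact region_locally_P1.
  - exact w_caloric.
  - intros z t h. apply cl_continuity_interior; [apply hreg|exact h].
  - intros z t h. apply cl_continuity_interior; [apply hreg|exact h].
  - assert (hc := w_caloric).
    (* The z-derivative of [lq_zz], with [w4] in the place of w_zzzz. *)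
    exists (fun z t => w4 z t * / w z t - 2 * lq z t * wzzz z t * / w z t
      - lq_z z t * wzz z t * / w z t + lq z t * lq z t * wzz z t * / w z t
      - 2 * (lq_z z t * lq_z z t) - 2 * lq z t * lq_zz z t).
    constructor.
    + apply hP1.
    + exact s_continuity.
    + exact lq_space_deriv.
    + exact lq_z_space_deriv.
    + intros z t h. destruct (hsign z t (region_cl_region _ _ _ _ h)) as [hw _].
      assert (d0 := cal_x _ _ _ _ _ hc z t h). assert (d1 := cal_xx _ _ _ _ _ hc z t h).
      assert (d2 := cal_xxx _ _ _ _ _ hc z t h). destruct (Hw4 z t h) as [d3 _].
      unfold lq_zz, lq_z, lq. auto_derive.
      * repeat split; try (eexists; eassumption); lra.
      * rewrite (is_derive_unique (fun x : R => w x t) _ _ d0),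
          (is_derive_unique (fun x : R => wz x t) _ _ d1),
          (is_derive_unique (fun x : R => wzz x t) _ _ d2),
          (is_derive_unique (fun x : R => wzzz x t) _ _ d3). field. lra.
    + intros z t h. destruct (hsign z t (region_cl_region _ _ _ _ h)) as [hw _].
      assert (d0 := cal_t _ _ _ _ _ hc z t h). assert (d1 := cal_xt _ _ _ _ _ hc z t h).
      unfold lq_zz, lq_z, lq. auto_derive.
      * repeat split; try (eexists; eassumption); lra.
      * rewrite (is_derive_unique (fun x : R => w z x) _ _ d0),
          (is_derive_unique (fun x : R => wz z x) _ _ d1). field. lra.
    + intros z t h. destruct (hsign z t (region_cl_region _ _ _ _ h)) as [hw _].
      assert (d0 := cal_t _ _ _ _ _ hc z t h). assert (d1 := cal_xt _ _ _ _ _ hc z t h).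
      destruct (Hw4 z t h) as [_ [d2 _]].
      unfold lq_zz, lq_z, lq. auto_derive.
      * repeat split; try (eexists; eassumption); lra.
      * rewrite (is_derive_unique (fun x : R => w z x) _ _ d0),
          (is_derive_unique (fun x : R => wz z x) _ _ d1),
          (is_derive_unique (fun x : R => wzz z x) _ _ d2). field. lra.
    + intros z t ht. now apply lq_clamped_continuity.
    + intros z t ht. now apply lq_z_clamped_continuity.
    + intros z t ht. now apply lq_zz_clamped_continuity.
    + intros z t h. destruct (hsign z t (region_cl_region _ _ _ _ h)) as [hw _].
      destruct (Hw4 z t h) as [_ [_ c4]].
      assert (c0 := cal_cont _ _ _ _ _ hc z t h). assert (c1 := cal_x_cont _ _ _ _ _ hc z t h).
      assert (c2 := cl_continuity_interior wzz z t (lat_wzz_cont _ _ _ _ _ hreg) h).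
      assert (c3 := cl_continuity_interior wzzz z t (lat_wzzz_cont _ _ _ _ _ hreg) h).
      assert (ci : continuity_2d_pt (fun z t => / w z t) z t)
        by (apply continuity_2d_pt_inv; [exact c0|lra]).
      unfold lq_zz, lq_z, lq. cont2d.
    + intros z t h. destruct (hsign z t h) as [hw hwz].
      unfold lq. assert (0 < / w z t) by now apply Rinv_0_lt_compat. nra.
    + exact hneg.
Qed.

(** * Derivatives along the boundary curves and limits at t = 0 *)

Lemma s_curve_P1 b : 0 < b -> 0 <= s b <= s b.
Proof. intros hb. assert (h := P1_s_pos _ _ _ _ _ _ _ _ hP1 b hb). lra. Qed.

(** Continuity of s', required by [lateral_derive], is not assumed: the Stefan condition expresses
    s' by functions already known to be continuous. *)
Lemma Derive_s t : 0 < t ->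
  is_derive s t (Derive s t) /\ Derive s t = - (lq (s t) t * (wm t / L t)) /\
  continuity_pt (Derive s) t.
Proof.
  intros ht.
  assert (e : forall t, 0 < t -> Derive s t = - (lq (s t) t * (wm t / L t))).
  { clear t ht. intros t ht. assert (hl := data_L_pos _ _ _ hdata t ht).
    assert (hw := proj1 (data_wm_bounds _ _ _ hdata t ht)).
    assert (h := P1_stefan _ _ _ _ _ _ _ _ hP1 t ht). unfold lq.
    rewrite (P1_free_value _ _ _ _ _ _ _ _ hP1 t ht), h. field. lra. }
  split; [now apply Derive_correct, (P1_s_diff _ _ _ _ _ _ _ _ hP1)|]. split; [now apply e|].
  assert (hpos : locally t (fun t => 0 < t)) by now apply open_gt.
  apply (continuity_pt_ext_loc (fun t => - (lq (s t) t * (wm t / L t)))).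
  - revert hpos. apply filter_imp. intros b hb. symmetry. now apply e.
  - assert (c1 := continuity_pt_curve s lq s t ht s_curve_P1 (s_continuity t ht)
      (lq_clamped_continuity _ t ht)).
    destruct (data_wm_diff _ _ _ hdata t ht) as [l hl].
    assert (c2 := is_derive_continuity_pt _ _ _ hl).
    assert (c3 := continuous_on_continuity_pt _ _ t (data_L_cont _ _ _ hdata) hpos).
    apply continuity_pt_opp, continuity_pt_mult; [exact c1|].
    apply continuity_pt_div; auto. assert (h := data_L_pos _ _ _ hdata t ht). lra.
Qed.

Lemma w_curve_derive (c dc : R -> R) t0 : 0 < t0 ->
  (forall t, 0 < t -> 0 <= c t <= s t) ->
  (forall t, 0 < t -> is_derive c t (dc t)) -> continuity_pt dc t0 ->
  is_derive (fun t => w (c t) t) t0 (wz (c t0) t0 * dc t0 + wzz (c t0) t0).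
Proof.
  intros ht0 hc hdc hdcc.
  apply (lateral_derive w wz wzz s (Derive s) c dc t0 t0); auto.
  - intros t ht. apply Rabs_def2 in ht. assert (hp : 0 < t) by lra.
    split; [now apply (P1_s_pos _ _ _ _ _ _ _ _ hP1)|]. split; [now apply hc|].
    split; [now apply Derive_s|now apply hdc].
  - now apply Derive_s.
  - intros x t ht hx. apply Rabs_def2 in ht.
    assert (hr := region_zero s x t ltac:(lra) hx).
    split; [now apply (cal_x _ _ _ _ _ w_caloric)|].
    split; [now apply (cal_t _ _ _ _ _ w_caloric)|now apply (cal_x_cont _ _ _ _ _ w_caloric)].
  - intros x t ht. apply Rabs_def2 in ht. apply clamped_continuity_P1; [apply hreg|lra].
  - apply clamped_continuity_P1; [apply hreg|lra].
  - apply clamped_continuity_P1; [apply hreg|lra].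
Qed.

(** The value of wm' comes from differentiating w(s(t),t) = wm(t). As w_t is given only inside, w_zz
    up to the boundary takes its place. *)
Lemma wm_derive t : 0 < t -> is_derive wm t
  (wm t * (lq (s t) t * Derive s t + lq_z (s t) t + lq (s t) t ^ 2)).
Proof.
  intros ht. apply (is_derive_ext_loc (fun t => w (s t) t)).
  - assert (hpos : locally t (fun t => 0 < t)) by now apply open_gt.
    revert hpos. apply filter_imp. apply (P1_free_value _ _ _ _ _ _ _ _ hP1).
  - destruct (Derive_s t ht) as (h1 & h2 & h3).
    assert (h := w_curve_derive s (Derive s) t ht s_curve_P1 (fun b hb => proj1 (Derive_s b hb)) h3).
    assert (hw := proj1 (data_wm_bounds _ _ _ hdata t ht)).
    assert (e : wm t * (lq (s t) t * Derive s t + lq_z (s t) t + lq (s t) t ^ 2)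
            = wz (s t) t * Derive s t + wzz (s t) t).
    { unfold lq_z, lq. rewrite (P1_free_value _ _ _ _ _ _ _ _ hP1 t ht). field. lra. }
    now rewrite e.
Qed.

Lemma v_derive t : 0 < t -> is_derive v t (v t * (lq_z 0 t + lq 0 t ^ 2)).
Proof.
  intros ht. apply (is_derive_ext_loc (fun t => w 0 t)).
  - assert (hpos : locally t (fun t => 0 < t)) by now apply open_gt.
    revert hpos. apply filter_imp. apply (P1_fixed_value _ _ _ _ _ _ _ _ hP1).
  - assert (h := w_curve_derive (fun _ => 0) (fun _ => 0) t ht
      (fun b hb => conj (Rle_refl 0) (proj1 (s_curve_P1 b hb)))
      (fun b _ => is_derive_const 0 b) (continuity_pt_cst 0 t)).
    simpl in h. assert (hw := data_v_pos _ _ _ hdata t ht).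
    assert (e : v t * (lq_z 0 t + lq 0 t ^ 2) = wz 0 t * 0 + wzz 0 t).
    { unfold lq_z, lq. rewrite (P1_fixed_value _ _ _ _ _ _ _ _ hP1 t ht). field. lra. }
    now rewrite e.
Qed.

Lemma continuous_on_at_right (f : R -> R) :
  continuous_on (fun t => 0 <= t) f -> filterlim f (at_right 0) (locally (f 0)).
Proof.
  intros hf P HP. specialize (hf 0 (Rle_refl 0) P HP). unfold filtermap, at_right, within in *.
  revert hf. apply filter_imp. intros t h ht. apply h. lra.
Qed.

Lemma lq_right_lim : 0 < wm 0 -> filterlim (fun t => wz (s t) t) (at_right 0) (locally 0) ->
  filterlim (fun t => lq (s t) t) (at_right 0) (locally 0).
Proof.
  intros hwm0 hinit. apply (filterlim_ext_loc (fun t => wz (s t) t * / wm t)).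
  { exists (mkposreal 1 Rlt_0_1). intros t _ ht. unfold lq. now rewrite (P1_free_value _ _ _ _ _ _ _ _ hP1 t ht). }
  replace 0 with (0 * / wm 0) at 2 by ring.
  apply (filterlim_comp_2 (H := locally (/ wm 0)) (fun t => wz (s t) t) (fun t => / wm t)
    Rmult hinit).
  - apply (filterlim_comp _ _ _ wm Rinv _ (locally (wm 0))).
    + apply continuous_on_at_right, hdata.
    + apply continuous_Rinv. lra.
  - apply (filterlim_mult (K := R_AbsRing)).
Qed.

End Heat.

(** The parametrization fixes theta only on the closed region, hence the second half speaks of every
    triple that it admits; the first half shows that there is one. *)
Theorem theorem2p8 (sigma m : R) (L v wm : R -> R)
    (w wz wt wzz wzzz : R -> R -> R) (s : R -> R)
    (hsigma : 0 < sigma) (hm : 0 < m)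
    (hdata : P1_data L v wm)
    (hP1 : P1_solution L v wm w wz wt wzz s)
    (* from the literature on (P1): *)
    (hsign : forall z t, cl_region zero_curve s z t -> 0 < w z t /\ wz z t <= 0)
    (* the expressions in the conclusion are meaningful: *)
    (hreg : lateral_regularity w wz wzz wzzz s)
    (hwm0 : 0 < wm 0)
    (hdet : forall z t, cl_region zero_curve s z t -> det w wz wzz z t <> 0)
    (horder : forall t, 0 < t ->
       y_par sigma m w wz 0 t < y_par sigma m w wz (s t) t)
    (* compatibility at t = 0, as I_0 and I_1 vanish there: *)
    (hinit : filterlim (fun t => wz (s t) t) (at_right 0) (locally 0)) :
  (exists (theta : R -> R -> R) (Y0 Y1 : R -> R),
      parametric sigma m w wz wzz s theta Y0 Y1)
  /\
  (forall (theta : R -> R -> R) (Y0 Y1 : R -> R),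
      parametric sigma m w wz wzz s theta Y0 Y1 ->
      exists theta_y : R -> R -> R,
        P4_solution sigma m L v wm theta theta_y Y0 Y1).
Proof.
  pose (q := lq w wz). pose (q1 := lq_z w wz wzz). pose (q2 := lq_zz w wz wzz wzzz).
  assert (hneg : forall z t, cl_region zero_curve s z t -> q1 z t < 0).
  { eapply (lq_z_neg) with (sigma := sigma) (m := m); eassumption. }
  destruct (lq_burgers L v wm w wz wt wzz wzzz s hP1 hsign hreg hneg) as [q3 hB].
  fold q q1 q2 in hB.
  assert (ey : forall z t, cl_region zero_curve s z t -> y_par sigma m w wz z t = Yq sigma m q z t).
  { intros z t h. destruct (hsign z t h) as [hw _]. unfold y_par, Yq, uq, q, lq.
    do 2 f_equal. field. lra. }
  assert (et : forall z t, cl_region zero_curve s z t ->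
            theta_par sigma m w wz wzz z t = thq sigma m q q1 z t).
  (* Dividing numerator and denominator of [theta_par] by w^2 gives m q - sigma / 2 = - (sigma / 2)
     [uq] over [lq_z]. *)
  { intros z t h. destruct (hsign z t h) as [hw _]. assert (hd := hdet z t h).
    unfold theta_par, thq, uq, q, q1, lq_z, lq, det in *. simpl in *. field.
    repeat split; lra. }
  assert (h0 : forall t, 0 < t -> cl_region zero_curve s 0 t) by (apply (cl_left s q q1 q2 q3 hB)).
  assert (h1 : forall t, 0 < t -> cl_region zero_curve s (s t) t) by (apply (cl_right s q q1 q2 q3 hB)).
  split.
  - exists (fun y t => thq sigma m q q1 (Zq sigma m s q q1 y t) t),
      (fun t => Yq sigma m q 0 t), (fun t => Yq sigma m q (s t) t).
    constructor.
    + intros t ht. symmetry. apply ey, h0, ht.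
    + intros t ht. symmetry. apply ey, h1, ht.
    + intros z t h. rewrite ey by exact h. split; [apply h|].
      now apply (Yq_range sigma m s q q1 q2 q3).
    + intros y t [ht hy]. exists (Zq sigma m s q q1 y t).
      assert (hz : 0 <= Zq sigma m s q q1 y t <= s t) by now apply (Zq_range sigma m s q q1 q2 q3).
      assert (hc := cl_region_zero s _ t ht hz). split.
      * split; [exact hc|]. rewrite ey by exact hc. symmetry.
        now apply (Yq_Zq sigma m s q q1 q2 q3).
      * intros z' [hz' e]. rewrite ey in e by exact hz'. rewrite e.
        now apply (Zq_Yq sigma m s q q1 q2 q3).
    + intros z t h. rewrite ey, et by exact h. now rewrite (Zq_Yq sigma m s q q1 q2 q3).
  - intros theta Y0 Y1 hpar. exists (thq_y sigma m s q q1 q2).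
    apply (parametric_P4_solution sigma m s q q1 q2 q3 hsigma hm hB theta Y0 Y1) with (ds := Derive s).
    + intros t ht. rewrite (par_Y0 _ _ _ _ _ _ _ _ _ hpar t ht). apply ey, h0, ht.
    + intros t ht. rewrite (par_Y1 _ _ _ _ _ _ _ _ _ hpar t ht). apply ey, h1, ht.
    + intros z t h. rewrite <- ey, <- et by exact h.
      now apply (par_theta _ _ _ _ _ _ _ _ _ hpar).
    + apply hdata.
    + intros t ht. now apply (data_wm_bounds _ _ _ hdata).
    + apply hdata.
    + intros t ht. eapply Derive_s; eassumption.
    + intros t ht. eapply Derive_s; eassumption.
    + intros t ht. eapply Derive_s; eassumption.
    + intros t ht. eapply wm_derive; eassumption.
    + intros t ht. eapply v_derive; eassumption.
    + rewrite <- (data_initial _ _ _ hdata). apply continuous_on_at_right, hdata.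
    + exact hwm0.
    + eapply lq_right_lim; eassumption.
Qed.
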